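(* For $q>1$ and $r\in\mathbb{R}$, there exists a singular solution $u$ of $-\Delta u=u^re^{u^q}$ (around the origin of $\mathbb{R}^2$) satisfying $$u(x)=\bigg(\log\frac1{|x|^2}-\frac{2q+r-1}{q}\log\log\frac1{|x|^2}+\log\frac{4(q-1)}{q^2}\bigg)^{\frac1q}+O\bigg(\frac{\log(-\log|x|)}{(-\log|x|)^{2-\frac1q}}\bigg)\qquad\text{as }|x|\to0 .$$
   Context: The space dimension is $2$ and $B_{R}=\{x\in\mathbb{R}^2:|x|<R\}$. A function $u\ge0$ is a singular solution of $-\Delta u=f(u)$ if there is $r_0>0$ such that $u\in C^2(B_{r_0}\setminus\{0\})$ satisfies $-\Delta u=f(u)$ in $B_{r_0}\setminus\{0\}$ in the classical sense and $u(x)\to\infty$ as $|x|\to0$. *)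

(* Defs.v *)
From Stdlib Require Import Reals.
From Coquelicot Require Import Coquelicot.

Open Scope R_scope.

Definition euclid_norm (p : R * R) : R := sqrt (fst p ^ 2 + snd p ^ 2).

Definition punctured_ball (rho : R) (p : R * R) : Prop :=
  0 < euclid_norm p < rho.

(* [ex_diff_n u 2] at every point of an open set means that [u] and all its
   partial derivatives of order at most 2 exist and are (jointly) continuous
   there, i.e. that [u] is C^2 on that set. *)
Definition C2_on (D : R * R -> Prop) (u : R -> R -> R) : Prop :=
  forall x y : R, D (x, y) -> ex_diff_n u 2 x y.

Definition laplacian (u : R -> R -> R) (x y : R) : R :=
  partial_derive 2 0 u x y + partial_derive 0 2 u x y.

(* The value of [u] at the origin and away from the punctured ball is
   irrelevant. *)
Definition singular_solution (f : R -> R) (u : R -> R -> R) : Prop :=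
  (exists rho : R,
     0 < rho /\
     C2_on (punctured_ball rho) u /\
     forall x y : R, punctured_ball rho (x, y) ->
       0 <= u x y /\ - laplacian u x y = f (u x y)) /\
  filterlim (fun p : R * R => u (fst p) (snd p))
    (locally' ((0, 0) : R * R)) (Rbar_locally p_infty).

(* Real powers of a nonnegative base: [Rpower 0 a] is 1 for every [a], so the
   base 0 is treated apart, with 0^0 = 1.  The value 0 for [x = 0], [a < 0] is
   a convention; it plays no role near the origin for a function tending to
   infinity there. *)
Definition rpow (x a : R) : R :=
  if Rlt_dec 0 x then Rpower x a else if Req_EM_T a 0 then 1 else 0.

Definition is_bigO {T : Type} (F : (T -> Prop) -> Prop) (f g : T -> R) : Prop :=
  exists C : R, F (fun x => Rabs (f x) <= C * Rabs (g x)).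

(* Main.v *)
Require Import Defs.
From Stdlib Require Import Reals.
From Stdlib Require Import Ranalysis5 Lra Lia Psatz ssreflect ClassicalEpsilon.
From Coquelicot Require Import Coquelicot.

(** With [t = ln (1 / |x|^2)], a radial [u = W t] solves the equation iff
    [- 4 e^t W'' = W^r exp (W^q)].  Hodograph transform: take [v = W^q] as the
    independent variable.  With [a = (2q+r-1)/q], [b = 1 - 1/q],
    [c = ln (4b/q)], [t = v + a ln v - c + Z] and [P = dt/dv] the equation is
    free of logarithms: [Z_v = P - 1 - a/v], [P_v = (b/v) (P^3 e^{-Z} - P)].
    Its linearisation at [Z = 0], [P = 1] is [z'' - (2b/v) z' + (b/v) z = 0],
    whose solutions oscillate in [sqrt v] with growing amplitude, so the
    non-oscillating solution is found by a contraction from infinity: after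
    subtracting the first term [d/v] of its formal expansion, the remaining
    source decays fast enough for variation of constants in [s = v^{-1/2}],
    where infinity becomes [s = 0] and all integrals are proper.  This yields
    [t = v + a ln v - c + O(1/v)]; inverting it gives [W]. *)

(** * A contraction principle for bounded continuous functions *)

(** The constants [a] and [c] are forced: since [e^t = e^v v^a e^{-c} e^Z], the factor [e^v]
    cancels, the powers of [v] match because [a - 2 + 1/q = r/q], and the numerical factors match
    because [e^c = 4b/q]. The homogeneous solutions have amplitude growing like [v^(1/4 + b)];
    letting the amplitudes vanish at infinity excludes them. The obstacle is that estimates by
    absolute values ignore the cancellation in the oscillating integrals. A bounded source [G]
    yields [eta = O(s^3)], and feeding [eta] back costs only [s^(-2)], so the map gains a factor
    [O(s)] and a small interval makes it a contraction. Without subtracting [d/v] these estimates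
    would start from [G = O(s^(-2))] and [eta = O(s)], and the nonlinearity would return terms of
    order [s^(-2)] again: shrinking the interval would gain nothing. The choice [b d = a + 2ab]
    cancels the order [1/v] of [remainder]. *)

Lemma exp_le (x y : R) : x <= y -> exp x <= exp y.
Proof.
  intros [H|H]; [left; apply exp_increasing, H|right; now rewrite H].
Qed.

(** The closed ball of radius [M] among bounded continuous functions on an open [D]; values off [D]
    are left free, so such functions are only ever compared on [D]. *)
Definition admissible (D : R -> Prop) (M : R) (G : R -> R) : Prop :=
  forall s, D s -> continuous G s /\ Rabs (G s) <= M.

Lemma continuous_eps (f : R -> R) (x : R) :
  (forall eps, 0 < eps -> locally x (fun y => Rabs (f y - f x) <= eps)) ->
  continuous f x.
Proof.
  intros H. apply filterlim_locally. intros eps.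
  assert (He : 0 < eps / 2) by (destruct eps; simpl; lra).
  apply: filter_imp (H _ He). intros y Hy.
  unfold ball; simpl; unfold AbsRing_ball, abs, minus, plus, opp; simpl.
  apply Rle_lt_trans with (eps / 2); [exact Hy | destruct eps; simpl; lra].
Qed.

Lemma continuous_eps_inv (f : R -> R) (x : R) :
  continuous f x ->
  forall eps, 0 < eps -> locally x (fun y => Rabs (f y - f x) <= eps).
Proof.
  intros H eps He.
  apply: filter_imp (proj1 (filterlim_locally _ _) H (mkposreal eps He)).
  intros y Hy. left. exact Hy.
Qed.

(** Banach's iteration started at the zero function. A uniform bound [e] stands in for the distance,
    so no function space or norm has to be built. *)
Lemma contraction_fixed_point (D : R -> Prop) (M : R) (T : (R -> R) -> R -> R) :
  open D -> 0 <= M ->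
  (forall G, admissible D M G -> admissible D M (T G)) ->
  (forall G1 G2 e, admissible D M G1 -> admissible D M G2 ->
     (forall s, D s -> Rabs (G1 s - G2 s) <= e) ->
     forall s, D s -> Rabs (T G1 s - T G2 s) <= e / 2) ->
  exists G, admissible D M G /\ forall s, D s -> G s = T G s.
Proof.
  intros HD HM HT Hc.
  set (Gn := fun n => Nat.iter n T (fun _ => 0)).
  assert (Hadm : forall n, admissible D M (Gn n)).
  { induction n as [|n IH]; [|exact (HT _ IH)].
    intros s _; split; [apply continuous_const|]. simpl. rewrite Rabs_R0; lra. }
  assert (Hstep : forall n s, D s -> Rabs (Gn (S n) s - Gn n s) <= M * (1/2)^n).
  { induction n as [|n IH]; intros s Hs.
    - simpl. rewrite Rminus_0_r Rmult_1_r. exact (proj2 (Hadm 1%nat s Hs)).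
    - replace (M * (1/2)^(S n)) with (M * (1/2)^n / 2) by (simpl; field).
      exact (Hc _ _ _ (Hadm _) (Hadm _) IH s Hs). }
  (* The exact partial sum of the geometric series is kept, so that the induction on [p] closes. *)
  assert (Hdist : forall n p s, D s ->
     Rabs (Gn (n + p)%nat s - Gn n s) <= 2 * M * (1/2)^n * (1 - (1/2)^p)).
  { intros n p s Hs. induction p as [|p IH].
    - rewrite Nat.add_0_r Rminus_diag Rabs_R0. simpl. lra.
    - replace (Gn (n + S p)%nat s - Gn n s) with
        ((Gn (S (n + p)) s - Gn (n + p)%nat s) + (Gn (n + p)%nat s - Gn n s))
        by (rewrite Nat.add_succ_r; ring).
      eapply Rle_trans; [apply Rabs_triang|].
      eapply Rle_trans; [apply Rplus_le_compat; [apply Hstep, Hs|exact IH]|].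
      rewrite pow_add. simpl. lra. }
  assert (Hpow : forall n, 0 < (1/2)^n) by (intros; apply pow_lt; lra).
  assert (Hdist' : forall n m s, (n <= m)%nat -> D s ->
     Rabs (Gn m s - Gn n s) <= 2 * M * (1/2)^n).
  { intros n m s Hnm Hs. replace m with (n + (m - n))%nat by lia.
    eapply Rle_trans; [apply Hdist, Hs|].
    assert (0 <= 2 * M * (1/2)^n * (1/2)^(m-n)).
    { repeat apply Rmult_le_pos; try lra; left; apply Hpow. }
    lra. }
  assert (Hsmall : forall e, 0 < e -> exists N, 2 * M * (1/2)^N < e).
  { intros e He.
    destruct (pow_lt_1_zero (1/2)) with (y := e / (2 * M + 1)) as [N HN].
    - rewrite Rabs_pos_eq; lra.
    - apply Rdiv_lt_0_compat; lra.
    - exists N. specialize (HN N (Nat.le_refl _)).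
      rewrite Rabs_pos_eq in HN; [|left; apply Hpow].
      apply (Rmult_lt_compat_l (2 * M + 1)) in HN; [|lra].
      replace ((2 * M + 1) * (e / (2 * M + 1))) with e in HN by (field; lra).
      specialize (Hpow N). lra. }
  set (G := fun s => real (Lim_seq (fun n => Gn n s))).
  assert (Hlim : forall s, D s -> is_lim_seq (fun n => Gn n s) (G s)).
  { intros s Hs. apply Lim_seq_correct', ex_lim_seq_cauchy_corr.
    intros e. destruct (Hsmall (e / 2)) as [N HN]; [destruct e; simpl; lra|].
    exists N. intros n m Hn Hm.
    replace (Gn n s - Gn m s) with ((Gn n s - Gn N s) - (Gn m s - Gn N s)) by ring.
    eapply Rle_lt_trans; [apply Rabs_triang|]. rewrite Rabs_Ropp.
    pose proof (Hdist' N n s Hn Hs). pose proof (Hdist' N m s Hm Hs). lra. }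
  assert (HG : forall n s, D s -> Rabs (G s - Gn n s) <= 2 * M * (1/2)^n).
  { intros n s Hs.
    assert (L : is_lim_seq (fun m => Rabs (Gn m s - Gn n s)) (Rabs (G s - Gn n s))).
    { apply (is_lim_seq_abs _ (Finite (G s - Gn n s))).
      apply is_lim_seq_minus'; [exact (Hlim s Hs)|apply is_lim_seq_const]. }
    refine (is_lim_seq_le_loc _ _ (Finite _) (Finite _) _ L (is_lim_seq_const _)).
    exists n. intros m Hm. apply Hdist'; assumption. }
  assert (HGadm : admissible D M G).
  { intros s Hs; split.
    - apply continuous_eps. intros e He.
      destruct (Hsmall (e / 3)) as [N HN]; [lra|].
      generalize (filter_and _ _ (HD s Hs)
        (continuous_eps_inv _ _ (proj1 (Hadm N s Hs)) (e / 3) ltac:(lra))).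
      apply filter_imp. intros y [Hy Hy2].
      replace (G y - G s) with
        ((G y - Gn N y) + (Gn N y - Gn N s) - (G s - Gn N s)) by ring.
      eapply Rle_trans; [apply Rabs_triang|]. rewrite Rabs_Ropp.
      pose proof (Rabs_triang (G y - Gn N y) (Gn N y - Gn N s)).
      pose proof (HG N y Hy). pose proof (HG N s Hs). lra.
    - refine (is_lim_seq_le (fun n => Rabs (Gn n s)) (fun _ => M)
        (Finite _) (Finite M) _ _ (is_lim_seq_const _)).
      + intros n. apply Hadm, Hs.
      + apply (is_lim_seq_abs _ (Finite (G s))), Hlim, Hs. }
  exists G; split; [exact HGadm|]. intros s Hs.
  apply cond_eq. intros e He.
  destruct (Hsmall (e / 2)) as [N HN]; [lra|].
  (* Both [G] and [T G] are close to [Gn (S N) = T (Gn N)], the latter by the contraction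
     property. *)
  replace (G s - T G s) with ((G s - Gn (S N) s) - (T G s - T (Gn N) s))
    by (change (Gn (S N) s) with (T (Gn N) s); ring).
  eapply Rle_lt_trans; [apply Rabs_triang|]. rewrite Rabs_Ropp.
  pose proof (HG (S N) s Hs) as H1.
  pose proof (Hc G (Gn N) _ HGadm (Hadm N) (HG N) s Hs) as H2.
  simpl in H1. change (Gn (S N) s) with (T (Gn N) s). lra.
Qed.

(** * Primitives vanishing at the origin *)

Lemma rpow_pos (x a : R) : 0 < x -> rpow x a = Rpower x a.
Proof. unfold rpow; intros; destruct (Rlt_dec 0 x); lra. Qed.

Lemma rpow_neg (x a : R) : x <= 0 -> a <> 0 -> rpow x a = 0.
Proof.
  unfold rpow; intros; destruct (Rlt_dec 0 x); [lra|].
  destruct (Req_EM_T a 0); [lra|reflexivity].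
Qed.

Lemma Rpower_gt0 (x a : R) : 0 < Rpower x a.
Proof. apply exp_pos. Qed.

Lemma continuous_Rpower (x a : R) : 0 < x -> continuous (fun s => Rpower s a) x.
Proof.
  intros Hx. apply: ex_derive_continuous. unfold Rpower. auto_derive. exact Hx.
Qed.

Lemma Rpower_le_self (x m : R) : 0 < x <= 1 -> 1 <= m -> Rpower x m <= x.
Proof.
  intros [Hx Hx1] Hm. rewrite -{2}(Rpower_1 x Hx).
  unfold Rpower. apply exp_le.
  assert (ln x <= 0) by (rewrite -ln_1; apply ln_le; lra). nra.
Qed.

(** [rpow] vanishes for [s <= 0] when [m <> 0], so the integrand extends continuously to the
    endpoint 0, where [psi] may oscillate without limit; [Rpower] would take the value 1 there. *)
Definition weighted_primitive (m : R) (psi : R -> R) (x : R) : R :=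
  RInt (fun s => rpow s m * psi s) 0 x.

Section WeightedPrimitive.

Variables (m s0 : R).
Hypotheses (Hm : 1 <= m) (Hs0 : 0 < s0 <= 1).
Let D (s : R) := 0 < s < s0.

Lemma open_domain : open D.
Proof. apply open_and; [apply open_gt|apply open_lt]. Qed.

(** At 0 the weight satisfies [s^m <= s], which absorbs a merely bounded [psi]. In the radius
    [e / (K + 1)] the added 1 avoids a division by zero. *)
Lemma continuous_weighted (K : R) (psi : R -> R) (x : R) :
  admissible D K psi -> 0 <= x < s0 -> continuous (fun s => rpow s m * psi s) x.
Proof.
  intros Hpsi Hx. destruct (Req_dec x 0) as [->|Hx0].
  - apply continuous_eps. intros e He. rewrite (rpow_neg 0); try lra.
    assert (HK : 0 <= K).
    { destruct (Hpsi (s0 / 2)) as [_ H]; [unfold D; lra|].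
      pose proof (Rabs_pos (psi (s0/2))). lra. }
    assert (Hd : 0 < Rmin s0 (e / (K + 1))).
    { apply Rmin_glb_lt; [lra|apply Rdiv_lt_0_compat; lra]. }
    exists (mkposreal _ Hd). intros y Hy.
    change (Rabs (y - 0) < Rmin s0 (e / (K + 1))) in Hy.
    rewrite Rminus_0_r in Hy. rewrite Rmult_0_l Rminus_0_r.
    destruct (Rle_dec y 0) as [Hy0|Hy0].
    + rewrite rpow_neg; try lra. rewrite Rmult_0_l Rabs_R0. lra.
    + rewrite Rabs_pos_eq in Hy; [|lra].
      pose proof (Rmin_l s0 (e / (K + 1))). pose proof (Rmin_r s0 (e / (K + 1))).
      rewrite rpow_pos; [|lra]. rewrite Rabs_mult Rabs_pos_eq; [|left; apply Rpower_gt0].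
      pose proof (Rpower_le_self y m ltac:(lra) Hm).
      assert (Hp : Rabs (psi y) <= K) by (apply Hpsi; unfold D; lra).
      apply Rle_trans with (y * K).
      * apply Rmult_le_compat; try assumption; [left; apply Rpower_gt0|apply Rabs_pos].
      * assert (y * (K + 1) <= e / (K + 1) * (K + 1)) by (apply Rmult_le_compat_r; lra).
        replace (e / (K + 1) * (K + 1)) with e in H2 by (field; lra). nra.
  - apply (continuous_mult (fun s => rpow s m) psi).
    + apply (continuous_ext_loc _ (fun s => Rpower s m)).
      * assert (Hd : locally x (fun y => 0 < y)) by (apply open_gt; lra).
        revert Hd. apply filter_imp. intros y Hy. rewrite rpow_pos; auto.
      * apply continuous_Rpower; lra.
    + apply Hpsi. unfold D; lra.
Qed.

Lemma ex_RInt_weighted (K : R) (psi : R -> R) (x : R) :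
  admissible D K psi -> 0 <= x < s0 -> ex_RInt (fun s => rpow s m * psi s) 0 x.
Proof.
  intros Hpsi Hx. apply (ex_RInt_continuous (V := R_CompleteNormedModule)).
  intros z. rewrite Rmin_left ?Rmax_right; try lra.
  intros Hz. apply (continuous_weighted K); [assumption|lra].
Qed.

Lemma is_derive_weighted_primitive (K : R) (psi : R -> R) (x : R) :
  admissible D K psi -> 0 < x < s0 ->
  is_derive (weighted_primitive m psi) x (Rpower x m * psi x).
Proof.
  intros Hpsi Hx. rewrite -rpow_pos; [|lra].
  apply (is_derive_RInt (fun s => rpow s m * psi s) _ 0).
  - generalize (open_domain x Hx). apply filter_imp. intros y Hy.
    apply (RInt_correct (V := R_CompleteNormedModule)).
    apply (ex_RInt_weighted K); [assumption|unfold D in Hy; lra].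
  - apply (continuous_weighted K); [assumption|lra].
Qed.

(** The integrand is at most [e x^m] on an interval of length [x]. The difference form serves twice:
    for the contraction, and with [psi2 = 0] for the size. *)
Lemma weighted_primitive_diff (K1 K2 e : R) (psi1 psi2 : R -> R) (x : R) :
  admissible D K1 psi1 -> admissible D K2 psi2 ->
  (forall s, D s -> Rabs (psi1 s - psi2 s) <= e) -> 0 < x < s0 ->
  Rabs (weighted_primitive m psi1 x - weighted_primitive m psi2 x)
    <= e * Rpower x (m + 1).
Proof.
  intros H1 H2 He Hx. unfold weighted_primitive.
  assert (E1 := ex_RInt_weighted _ _ x H1 ltac:(lra)).
  assert (E2 := ex_RInt_weighted _ _ x H2 ltac:(lra)).
  change (Rabs (minus (RInt (fun s => rpow s m * psi1 s) 0 x)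
                      (RInt (fun s => rpow s m * psi2 s) 0 x)) <= e * Rpower x (m+1)).
  rewrite -(RInt_minus (V := R_CompleteNormedModule)); try assumption.
  apply Rle_trans with ((x - 0) * (e * Rpower x m)).
  - apply abs_RInt_le_const; [lra| |].
    + apply (ex_RInt_minus (V := R_NormedModule)); assumption.
    + intros t Ht.
      change (Rabs (rpow t m * psi1 t - rpow t m * psi2 t) <= e * Rpower x m).
      assert (0 <= e).
      { eapply Rle_trans; [apply Rabs_pos|apply (He x Hx)]. }
      destruct (Req_dec t 0) as [->|Ht0].
      * rewrite rpow_neg; try lra. rewrite !Rmult_0_l Rminus_0_r Rabs_R0.
        apply Rmult_le_pos; [assumption|left; apply Rpower_gt0].
      * rewrite rpow_pos; [|lra]. rewrite -Rmult_minus_distr_l Rabs_mult Rmult_comm.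
        rewrite (Rabs_pos_eq (Rpower t m)); [|left; apply Rpower_gt0].
        apply Rmult_le_compat; try apply Rabs_pos; [left; apply Rpower_gt0| |].
        -- apply He. unfold D; lra.
        -- apply Rle_Rpower_l; lra.
  - rewrite Rpower_plus Rpower_1; [|lra]. lra.
Qed.

End WeightedPrimitive.

(** * The nonlinear remainder *)

Lemma exp_minus_1_bound (rho t : R) :
  rho <= 1 -> Rabs t <= rho -> Rabs (exp t - 1) <= 3 * rho.
Proof.
  intros Hr Ht. apply Rabs_le_between in Ht.
  pose proof (exp_ineq1_le t). pose proof (exp_ineq1_le (- t)) as Hn.
  pose proof (exp_pos t). pose proof exp_le_3.
  assert (exp t <= exp 1) by (apply exp_le; lra).
  assert (exp t * (1 + - t) <= 1).
  { apply Rle_trans with (exp t * exp (- t)).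
    - apply Rmult_le_compat_l; lra.
    - rewrite -exp_plus Rplus_opp_r exp_0. lra. }
  apply Rabs_le. split; nra.
Qed.

Lemma exp_sub_id_lipschitz (rho x y : R) :
  rho <= 1 -> Rabs x <= rho -> Rabs y <= rho ->
  Rabs (exp x - exp y - (x - y)) <= 3 * rho * Rabs (x - y).
Proof.
  intros Hr Hx Hy.
  destruct (MVT_gen (fun t => exp t - t) y x (fun t => exp t - 1)) as [c [Hc E]].
  - intros t _. auto_derive; [exact I|ring].
  - intros t _. apply derivable_continuous_pt. apply ex_derive_Reals_0.
    auto_derive. exact I.
  - replace (exp x - exp y - (x - y)) with ((exp c - 1) * (x - y)) by lra.
    rewrite Rabs_mult. apply Rmult_le_compat_r; [apply Rabs_pos|].
    apply exp_minus_1_bound; [exact Hr|].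
    apply Rabs_le_between. apply Rabs_le_between in Hx, Hy.
    revert Hc. unfold Rmin, Rmax. destruct (Rle_dec y x); lra.
Qed.

(** Once its linear part [3p + x] at the origin is removed, [(1 + p)^3 e^x] is quadratically small,
    hence Lipschitz with constant [O(rho)]. *)
Lemma cube_exp_lipschitz (rho p p' x x' : R) :
  rho <= 1 -> Rabs p <= rho -> Rabs p' <= rho -> Rabs x <= rho -> Rabs x' <= rho ->
  Rabs ((1 + p)^3 * exp x - (1 + p')^3 * exp x' - 3 * (p - p') - (x - x'))
    <= 45 * rho * (Rabs (p - p') + Rabs (x - x')).
Proof.
  intros Hr Hp Hp' Hx Hx'.
  pose proof (exp_sub_id_lipschitz rho x x' Hr Hx Hx') as H1.
  pose proof (exp_minus_1_bound rho x Hr Hx) as H2.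
  assert (H0 : 0 <= rho) by (eapply Rle_trans; [apply Rabs_pos|exact Hp]).
  (* [A] is the divided difference of [(1 + p)^3 - 3p], and [B] is [(1 + p')^3 - 1]; both are
     [O(rho)]. The constant is [45 = 9*3 + 9 + 3*3], from the coefficient of [p - p']. *)
  set (A := 3 * (p + p') + p^2 + p * p' + p'^2).
  set (B := 3 * p' + 3 * p'^2 + p'^3).
  replace ((1 + p)^3 * exp x - (1 + p')^3 * exp x' - 3 * (p - p') - (x - x'))
    with ((p - p') * (A * (exp x - 1) + A + 3 * (exp x - 1))
          + B * (exp x - exp x' - (x - x')) + B * (x - x')
          + (exp x - exp x' - (x - x'))) by (unfold A, B; ring).
  assert (HA : Rabs A <= 9 * rho).
  { unfold A. apply Rabs_le_between in Hp, Hp'. apply Rabs_le. split; nra. }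
  assert (HB : Rabs B <= 7 * rho).
  { unfold B. apply Rabs_le_between in Hp'.
    assert (0 <= p'^2 <= rho) by nra.
    assert (Rabs (p'^3) <= rho).
    { replace (p'^3) with (p' * p'^2) by ring. apply Rabs_le. split; nra. }
    apply Rabs_le_between in H3. apply Rabs_le. split; lra. }
  set (e1 := exp x - 1) in *. set (e2 := exp x - exp x' - (x - x')) in *.
  pose proof (Rabs_pos (p - p')). pose proof (Rabs_pos (x - x')).
  pose proof (Rabs_pos A). pose proof (Rabs_pos B). pose proof (Rabs_pos e1).
  assert (HC : Rabs (A * e1 + A + 3 * e1) <= 45 * rho).
  { eapply Rle_trans; [apply Rabs_triang|]. rewrite (Rabs_mult 3) (Rabs_pos_eq 3); [|lra].
    assert (Rabs (A * e1 + A) <= Rabs A * Rabs e1 + Rabs A).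
    { eapply Rle_trans; [apply Rabs_triang|]. rewrite Rabs_mult. lra. }
    assert (Rabs A * Rabs e1 <= (9 * rho) * 3) by (apply Rmult_le_compat; lra).
    lra. }
  assert (HT : Rabs ((p - p') * (A * e1 + A + 3 * e1) + B * e2 + B * (x - x') + e2)
     <= Rabs (p - p') * (45 * rho) + Rabs B * Rabs e2 + Rabs B * Rabs (x - x') + Rabs e2).
  { repeat (eapply Rle_trans; [apply Rabs_triang|]; apply Rplus_le_compat;
      [|rewrite ?Rabs_mult; lra]).
    rewrite Rabs_mult. apply Rmult_le_compat_l; assumption. }
  eapply Rle_trans; [exact HT|].
  assert (Rabs B * Rabs e2 <= 7 * (3 * rho * Rabs (x - x'))).
  { apply Rmult_le_compat; try apply Rabs_pos; lra. }
  assert (Rabs B * Rabs (x - x') <= 7 * rho * Rabs (x - x')).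
  { apply Rmult_le_compat_r; lra. }
  nra.
Qed.

(* [v] times the source of the linearised equation for [eta = Z - d/v], where
   [h = deta/dv] and [e = 1/v]; [d] is chosen later so that it is
   O(e^2) at [eta = h = 0]. *)
Definition remainder (a b d e eta h : R) : R :=
  a * e - 2 * d * e^2
  + b * ((1 + (a * e - d * e^2 + h))^3 * exp (- d * e - eta)
         - (1 + (a * e - d * e^2 + h)) - 2 * h + eta).

Lemma Rabs_momentum_le (a d e h : R) :
  0 <= e <= 1 -> Rabs h <= e ->
  Rabs (a * e - d * e^2 + h) <= (1 + Rabs a + Rabs d) * e.
Proof.
  intros [He He1] Hh. eapply Rle_trans; [apply Rabs_triang|].
  assert (Rabs (a * e - d * e^2) <= (Rabs a + Rabs d) * e); [|lra].
  eapply Rle_trans; [apply Rabs_triang|].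
  rewrite Rabs_Ropp (Rabs_mult a) (Rabs_mult d) (Rabs_pos_eq e) ?(Rabs_pos_eq (e^2)); try nra.
  assert (Rabs d * e^2 <= Rabs d * e); [|lra].
  apply Rmult_le_compat_l; [apply Rabs_pos|nra].
Qed.

Lemma Rabs_exponent_le (a d e eta : R) :
  0 <= e -> Rabs eta <= e ->
  Rabs (- d * e - eta) <= (1 + Rabs a + Rabs d) * e.
Proof.
  intros He Hh. eapply Rle_trans; [apply Rabs_triang|].
  rewrite Rabs_Ropp Rabs_mult Rabs_Ropp (Rabs_pos_eq e); [|lra].
  pose proof (Rabs_pos a). nra.
Qed.

(** The linear terms of [remainder] in [eta] and [h] are exactly those removed in
    [cube_exp_lipschitz], which applies with [rho = (1 + |a| + |d|) e]. *)
Lemma remainder_lipschitz (a b d e eta h eta' h' : R) :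
  0 <= b -> 0 <= e <= 1 -> (1 + Rabs a + Rabs d) * e <= 1 ->
  Rabs eta <= e -> Rabs h <= e -> Rabs eta' <= e -> Rabs h' <= e ->
  Rabs (remainder a b d e eta h - remainder a b d e eta' h')
    <= 45 * b * (1 + Rabs a + Rabs d) * e * (Rabs (eta - eta') + Rabs (h - h')).
Proof.
  intros Hb He HK H1 H2 H3 H4.
  pose proof (cube_exp_lipschitz _ _ _ _ _ HK
    (Rabs_momentum_le a d e h He H2) (Rabs_momentum_le a d e h' He H4)
    (Rabs_exponent_le a d e eta (proj1 He) H1)
    (Rabs_exponent_le a d e eta' (proj1 He) H3)) as H.
  unfold remainder.
  set (P := a * e - d * e^2 + h) in *. set (P' := a * e - d * e^2 + h') in *.
  replace (Rabs (P - P')) with (Rabs (h - h')) in H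
    by (f_equal; unfold P, P'; ring).
  replace (Rabs (- d * e - eta - (- d * e - eta'))) with (Rabs (eta - eta')) in H
    by (rewrite -Rabs_Ropp; f_equal; ring).
  match type of H with Rabs ?X <= _ =>
    match goal with |- Rabs ?Y <= _ => replace Y with (b * X) by (unfold P, P'; ring) end end.
  rewrite Rabs_mult (Rabs_pos_eq b Hb).
  apply (Rmult_le_compat_l b) in H; [|exact Hb]. nra.
Qed.

(** Comparison with the origin in [cube_exp_lipschitz] leaves [a + 2ab - bd] as the coefficient of
    [e]; the hypothesis on [d] makes it vanish. *)
Lemma remainder_at_0 (a b d e : R) :
  0 <= b -> 0 <= e <= 1 -> (1 + Rabs a + Rabs d) * e <= 1 ->
  b * d = a + 2 * a * b ->
  Rabs (remainder a b d e 0 0)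
    <= (2 * Rabs d + b * (2 * Rabs d + 90 * (1 + Rabs a + Rabs d)^2)) * e^2.
Proof.
  intros Hb He HK Hd.
  assert (H0 : Rabs 0 <= e) by (rewrite Rabs_R0; lra).
  assert (HKe : 0 <= (1 + Rabs a + Rabs d) * e).
  { apply Rmult_le_pos; [|lra]. pose proof (Rabs_pos a). pose proof (Rabs_pos d). lra. }
  assert (H0' : Rabs 0 <= (1 + Rabs a + Rabs d) * e) by (rewrite Rabs_R0; lra).
  pose proof (Rabs_momentum_le a d e 0 He H0) as HP.
  pose proof (Rabs_exponent_le a d e 0 (proj1 He) H0) as HX.
  pose proof (cube_exp_lipschitz _ _ _ _ _ HK HP H0' HX H0') as H.
  unfold remainder.
  set (P := a * e - d * e^2 + 0) in *. set (X := - d * e - 0) in *.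
  rewrite !Rminus_0_r Rplus_0_r exp_0 in H.
  set (Y := (1 + P)^3 * exp X - 1^3 * 1 - 3 * P - X) in *.
  replace (a * e - 2 * d * e^2 + b * ((1 + P)^3 * exp X - (1 + P) - 2 * 0 + 0))
    with (b * Y + (- 2 * d * (1 + b) * e^2) + (a + 2 * a * b - b * d) * e)
    by (unfold Y, P, X; ring).
  rewrite -Hd Rminus_diag Rmult_0_l Rplus_0_r.
  eapply Rle_trans; [apply Rabs_triang|].
  rewrite (Rabs_mult b) (Rabs_mult _ (e^2)) (Rabs_mult _ (1 + b)) (Rabs_mult (-2)).
  rewrite (Rabs_pos_eq b Hb) (Rabs_pos_eq (e^2)); [|nra].
  rewrite (Rabs_pos_eq (1 + b)); [|lra].
  rewrite (Rabs_left (-2)); [|lra].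
  set (K := 1 + Rabs a + Rabs d) in *.
  assert (Rabs Y <= 90 * K^2 * e^2).
  { eapply Rle_trans; [exact H|].
    apply Rle_trans with (45 * (K * e) * (K * e + K * e)).
    - apply Rmult_le_compat_l; lra.
    - right; ring. }
  apply (Rmult_le_compat_l b) in H1; [|exact Hb]. lra.
Qed.

(** * Variation of constants for the oscillator *)

(* [osc_value] is [eta = s^{-k} y], where [y = al cos (w/s) + be sin (w/s)] is a
   modulated oscillation in [1/s = sqrt v]; [osc_slope] is [deta/dv] for
   [v = s^{-2}].  The power [s^{-k}] removes the first-order term of the
   equation for [y]. *)
Definition osc_value (w k : R) (al be : R -> R) (x : R) : R :=
  Rpower x (- k) * (al x * cos (w / x) + be x * sin (w / x)).

Definition osc_slope (w k : R) (al be : R -> R) (x : R) : R :=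
  x * Rpower x (- k) / 2 *
  (w * (be x * cos (w / x) - al x * sin (w / x))
   + k * x * (al x * cos (w / x) + be x * sin (w / x))).

(** The prescribed derivatives satisfy [al' cos + be' sin = 0], the usual side condition of
    variation of constants, so [g] does not appear. *)
Lemma is_derive_osc_value (w k g x : R) (al be : R -> R) :
  0 < x -> w <> 0 ->
  is_derive al x (sin (w / x) * g / w) ->
  is_derive be x (- (cos (w / x) * g / w)) ->
  is_derive (osc_value w k al be) x (- 2 * osc_slope w k al be x / x^3).
Proof.
  intros Hx Hw Hal Hbe. unfold osc_value, osc_slope, Rpower.
  auto_derive.
  - repeat split; try lra; eexists; eassumption.
  - rewrite (is_derive_unique (fun y => al y) _ _ Hal)
      (is_derive_unique (fun y => be y) _ _ Hbe). change (w * / x) with (w / x).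
    field. lra.
Qed.

(** Here the forcing enters. In the variable [1/s] it is [s^(k+4) g]; the Jacobian [s^(-2)] turns
    this into the weight [s^(k+2)] of the amplitudes. *)
Lemma is_derive_osc_slope (w k g x : R) (al be : R -> R) :
  0 < x -> w <> 0 ->
  is_derive al x (sin (w / x) * (Rpower x (k + 2) * g) / w) ->
  is_derive be x (- (cos (w / x) * (Rpower x (k + 2) * g) / w)) ->
  is_derive (osc_slope w k al be) x
    ((1 - 2 * k) / x * osc_slope w k al be x
     + (w^2 / (2 * x) + k * (k + 1) * x / 2) * osc_value w k al be x
     - x^3 * g / 2).
Proof.
  intros Hx Hw Hal Hbe.
  assert (E : Rpower x (k + 2) = x^2 / Rpower x (- k)).
  { rewrite Rpower_plus Rpower_Ropp.
    replace (Rpower x 2) with (x^2) by (rewrite -Rpower_pow //).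
    pose proof (Rpower_gt0 x k). field. lra. }
  rewrite E in Hal, Hbe. clear E.
  (* Writing [g] with the factor [cos^2 + sin^2] turns the final identity into pure field
     algebra. *)
  assert (Hg : g = g * ((cos (w / x))^2 + (sin (w / x))^2)).
  { pose proof (sin2_cos2 (w / x)) as H. unfold Rsqr in H.
    replace ((cos (w / x))^2 + (sin (w / x))^2) with 1 by (rewrite -H; ring). ring. }
  unfold osc_value, osc_slope. unfold Rpower in *.
  auto_derive.
  - repeat split; try lra; eexists; eassumption.
  - rewrite (is_derive_unique (fun y => al y) _ _ Hal)
      (is_derive_unique (fun y => be y) _ _ Hbe).
    change (w * / x) with (w / x).
    pose proof (exp_pos (- k * ln x)).
    rewrite [X in _ - x^3 * X / 2]Hg. field. lra.
Qed.

Lemma Rabs_osc_le (c s x y : R) :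
  Rabs c <= 1 -> Rabs s <= 1 -> Rabs (x * c + y * s) <= Rabs x + Rabs y.
Proof.
  intros Hc Hs. eapply Rle_trans; [apply Rabs_triang|].
  rewrite !Rabs_mult. pose proof (Rabs_pos x). pose proof (Rabs_pos y).
  pose proof (Rabs_pos c). pose proof (Rabs_pos s). nra.
Qed.

Lemma Rabs_sin_le (x : R) : Rabs (sin x) <= 1.
Proof. apply Rabs_le, SIN_bound. Qed.

Lemma Rabs_cos_le (x : R) : Rabs (cos x) <= 1.
Proof. apply Rabs_le, COS_bound. Qed.

(** Amplitudes of size [x^(k+3)] pay for the growing factor [x^(-k)] and leave [x^3]. *)
Lemma osc_value_le (w k : R) (al be : R -> R) (x e : R) :
  0 < x -> Rabs (al x) <= e * Rpower x (k + 3) -> Rabs (be x) <= e * Rpower x (k + 3) ->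
  Rabs (osc_value w k al be x) <= 2 * e * x^3.
Proof.
  intros Hx Hal Hbe. unfold osc_value.
  rewrite Rabs_mult Rabs_pos_eq; [|left; apply Rpower_gt0].
  replace (x^3) with (Rpower x (- k) * Rpower x (k + 3))
    by (rewrite -Rpower_plus -(Rpower_pow 3) //; f_equal; simpl; ring).
  pose proof (Rabs_osc_le _ _ (al x) (be x) (Rabs_cos_le (w / x)) (Rabs_sin_le (w / x))).
  pose proof (Rpower_gt0 x (- k)).
  apply Rle_trans with (Rpower x (- k) * (2 * e * Rpower x (k + 3))).
  - apply Rmult_le_compat_l; lra.
  - right; ring.
Qed.

(** One more power of [x] than for the value: differentiating the oscillation costs [x^(-2)], and
    [d/dv] is [-(x^3/2) d/dx]. *)
Lemma osc_slope_le (w k : R) (al be : R -> R) (x e : R) :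
  0 < x <= 1 -> 0 < w -> 0 <= k -> Rabs (al x) <= e * Rpower x (k + 3) ->
  Rabs (be x) <= e * Rpower x (k + 3) ->
  Rabs (osc_slope w k al be x) <= (w + k) * e * x^4.
Proof.
  intros Hx Hw Hk Hal Hbe.
  assert (He : 0 <= e * Rpower x (k + 3)) by (eapply Rle_trans; [apply Rabs_pos|exact Hal]).
  unfold osc_slope.
  rewrite Rabs_mult Rabs_pos_eq; [|pose proof (Rpower_gt0 x (- k)); nra].
  replace (x^4) with (x * Rpower x (- k) * Rpower x (k + 3)).
  2:{ rewrite Rmult_assoc -Rpower_plus. replace (- k + (k + 3)) with (INR 3) by (simpl; ring).
      rewrite Rpower_pow; [ring|lra]. }
  pose proof (Rabs_osc_le _ _ (al x) (be x) (Rabs_cos_le (w / x)) (Rabs_sin_le (w / x))) as H1.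
  assert (H2 : Rabs (be x * cos (w / x) - al x * sin (w / x)) <= Rabs (al x) + Rabs (be x)).
  { pose proof (Rabs_osc_le _ _ (be x) (- al x) (Rabs_cos_le (w / x)) (Rabs_sin_le (w / x))).
    rewrite Rabs_Ropp in H. unfold Rminus. rewrite Ropp_mult_distr_l. lra. }
  pose proof (Rpower_gt0 x (- k)).
  set (y1 := be x * cos (w / x) - al x * sin (w / x)) in *.
  set (y := al x * cos (w / x) + be x * sin (w / x)) in *.
  set (e' := e * Rpower x (k + 3)) in *.
  assert (Rabs (w * y1 + k * x * y) <= 2 * (w + k) * e').
  { eapply Rle_trans; [apply Rabs_triang|].
    rewrite !Rabs_mult (Rabs_pos_eq w) ?(Rabs_pos_eq k) ?(Rabs_pos_eq x); try lra.
    assert (w * Rabs y1 <= w * (2 * e')) by (apply Rmult_le_compat_l; lra).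
    assert (k * x * Rabs y <= k * 1 * (2 * e')).
    { apply Rmult_le_compat; try apply Rabs_pos; try lra; [nra|].
      apply Rmult_le_compat_l; lra. }
    lra. }
  apply Rle_trans with (x * Rpower x (- k) / 2 * (2 * (w + k) * e')).
  - apply Rmult_le_compat_l; [nra|assumption].
  - right; unfold e'; field.
Qed.

Lemma admissible_mult_osc (f : R -> R) (w M : R) (D : R -> Prop) (G : R -> R) :
  (forall x, continuous f x) -> (forall x, Rabs (f x) <= 1) ->
  (forall s, D s -> 0 < s) ->
  admissible D M G -> admissible D M (fun s => f (w / s) * G s).
Proof.
  intros Hc Hf HD HG s Hs. destruct (HG s Hs) as [H1 H2]. split.
  - apply (continuous_mult (fun s => f (w / s)) G); [|exact H1].
    apply (continuous_comp (fun s => w / s) f); [|apply Hc].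
    apply: ex_derive_continuous. auto_derive. pose proof (HD s Hs). lra.
  - rewrite Rabs_mult. pose proof (Hf (w / s)). pose proof (Rabs_pos (G s)).
    pose proof (Rabs_pos (f (w / s))). nra.
Qed.

Lemma weighted_primitive_0 (m x : R) (psi : R -> R) :
  (forall s, psi s = 0) -> weighted_primitive m psi x = 0.
Proof.
  intros H. unfold weighted_primitive.
  rewrite (RInt_ext _ (fun _ => 0)).
  - rewrite RInt_const. apply Rmult_0_r.
  - intros s _. rewrite H. apply Rmult_0_r.
Qed.

Section Oscillator.

Variables (b s0 : R).
Hypotheses (Hb : 0 < b) (Hs0 : 0 < s0 <= 1).
Let D (s : R) := 0 < s < s0.
(** With [sigma = 1/s = sqrt v] the linearised operator is, up to a factor,
    [z'' - ((1 + 4b)/sigma) z' + 4b z]. Substituting [z = sigma^k y] removes the first-order term if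
    [2k = 1 + 4b]; the frequency is then [sqrt (4b)], and the leftover [k(k+1) s^2 z] goes into the
    source. *)
Let k := 1 / 2 + 2 * b.
Let w := 2 * sqrt b.

(** Integrating from [s = 0], that is from [v] infinite, sets both constants of integration to zero
    and so discards the growing oscillations. *)
Definition amp_cos (G : R -> R) (x : R) : R :=
  weighted_primitive (k + 2) (fun s => sin (w / s) * G s) x / w.

Definition amp_sin (G : R -> R) (x : R) : R :=
  - (weighted_primitive (k + 2) (fun s => cos (w / s) * G s) x / w).

Definition corr (G : R -> R) : R -> R := osc_value w k (amp_cos G) (amp_sin G).
Definition slope (G : R -> R) : R -> R := osc_slope w k (amp_cos G) (amp_sin G).

Lemma frequency_pos : 0 < w.
Proof. unfold w. pose proof (sqrt_lt_R0 b Hb). lra. Qed.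

Lemma admissible_sin (M : R) (G : R -> R) :
  admissible D M G -> admissible D M (fun s => sin (w / s) * G s).
Proof.
  apply admissible_mult_osc; [apply continuous_sin|apply Rabs_sin_le|].
  unfold D; intros; lra.
Qed.

Lemma admissible_cos (M : R) (G : R -> R) :
  admissible D M G -> admissible D M (fun s => cos (w / s) * G s).
Proof.
  apply admissible_mult_osc; [apply continuous_cos|apply Rabs_cos_le|].
  unfold D; intros; lra.
Qed.

Lemma is_derive_amp_cos (M : R) (G : R -> R) (x : R) : admissible D M G -> D x ->
  is_derive (amp_cos G) x (sin (w / x) * (Rpower x (k + 2) * G x) / w).
Proof.
  intros HG Hx. pose proof frequency_pos.
  pose proof (is_derive_weighted_primitive (k + 2) s0 ltac:(unfold k; lra) Hs0
    _ _ x (admissible_sin _ _ HG) Hx) as Hd.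
  unfold amp_cos. revert Hd. set (I0 := weighted_primitive _ _). intros Hd.
  auto_derive; [eexists; exact Hd|].
  rewrite (is_derive_unique (fun y => I0 y) _ _ Hd). field. lra.
Qed.

Lemma is_derive_amp_sin (M : R) (G : R -> R) (x : R) : admissible D M G -> D x ->
  is_derive (amp_sin G) x (- (cos (w / x) * (Rpower x (k + 2) * G x) / w)).
Proof.
  intros HG Hx. pose proof frequency_pos.
  pose proof (is_derive_weighted_primitive (k + 2) s0 ltac:(unfold k; lra) Hs0
    _ _ x (admissible_cos _ _ HG) Hx) as Hd.
  unfold amp_sin. revert Hd. set (I0 := weighted_primitive _ _). intros Hd.
  auto_derive; [eexists; exact Hd|].
  rewrite (is_derive_unique (fun y => I0 y) _ _ Hd). field. lra.
Qed.

Lemma is_derive_corr (M : R) (G : R -> R) (x : R) : admissible D M G -> D x ->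
  is_derive (corr G) x (- 2 * slope G x / x^3).
Proof.
  intros HG Hx. pose proof frequency_pos. destruct Hx as [Hx1 Hx2].
  eapply is_derive_osc_value; [lra|lra| |].
  - eapply is_derive_amp_cos; [exact HG|split; lra].
  - eapply is_derive_amp_sin; [exact HG|split; lra].
Qed.

Lemma is_derive_slope (M : R) (G : R -> R) (x : R) : admissible D M G -> D x ->
  is_derive (slope G) x
    (- 4 * b / x * slope G x
     + (2 * b / x + k * (k + 1) * x / 2) * corr G x - x^3 * G x / 2).
Proof.
  intros HG Hx. pose proof frequency_pos. destruct Hx as [Hx1 Hx2].
  replace (- 4 * b / x) with ((1 - 2 * k) / x) by (unfold k; field; lra).
  replace (2 * b / x) with (w^2 / (2 * x)).
  2:{ unfold w. rewrite Rpow_mult_distr pow2_sqrt; [field; lra|lra]. }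
  apply is_derive_osc_slope; [lra|lra| |].
  - eapply is_derive_amp_cos; [exact HG|split; lra].
  - eapply is_derive_amp_sin; [exact HG|split; lra].
Qed.

Lemma amp_diff (M1 M2 e : R) (G1 G2 : R -> R) (x : R) :
  admissible D M1 G1 -> admissible D M2 G2 ->
  (forall s, D s -> Rabs (G1 s - G2 s) <= e) -> D x ->
  Rabs (amp_cos G1 x - amp_cos G2 x) <= e / w * Rpower x (k + 3) /\
  Rabs (amp_sin G1 x - amp_sin G2 x) <= e / w * Rpower x (k + 3).
Proof.
  intros H1 H2 He Hx. pose proof frequency_pos as Hw.
  assert (Htrig : forall f : R -> R, (forall y, Rabs (f y) <= 1) -> forall s, D s ->
     Rabs (f (w / s) * G1 s - f (w / s) * G2 s) <= e).
  { intros f Hf s Hs. rewrite -Rmult_minus_distr_l Rabs_mult.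
    pose proof (Hf (w / s)). pose proof (He s Hs).
    pose proof (Rabs_pos (G1 s - G2 s)). pose proof (Rabs_pos (f (w / s))). nra. }
  assert (Hscale : forall u v, Rabs (u - v) <= e * Rpower x (k + 2 + 1) ->
     Rabs (u / w - v / w) <= e / w * Rpower x (k + 3)).
  { intros u v Huv. replace (u / w - v / w) with ((u - v) * / w) by (field; lra).
    rewrite Rabs_mult (Rabs_pos_eq (/ w)); [|left; apply Rinv_0_lt_compat, Hw].
    replace (k + 2 + 1) with (k + 3) in Huv by ring.
    unfold Rdiv. rewrite (Rmult_comm e) Rmult_assoc Rmult_comm.
    apply Rmult_le_compat_l; [left; apply Rinv_0_lt_compat, Hw|exact Huv]. }
  assert (Hk : 1 <= k + 2) by (unfold k; lra).
  unfold amp_cos, amp_sin. split.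
  - apply Hscale. exact (weighted_primitive_diff _ s0 Hk Hs0 _ _ _ _ _ x
      (admissible_sin _ _ H1) (admissible_sin _ _ H2) (Htrig sin Rabs_sin_le) Hx).
  - rewrite -Rabs_Ropp. match goal with |- Rabs ?X <= _ => set (Y := X) end.
    match goal with Y := - (- ?u - - ?v) |- _ =>
      replace Y with (u - v) by (unfold Y; ring) end. clear Y.
    apply Hscale. exact (weighted_primitive_diff _ s0 Hk Hs0 _ _ _ _ _ x
      (admissible_cos _ _ H1) (admissible_cos _ _ H2) (Htrig cos Rabs_cos_le) Hx).
Qed.

(** [osc_value] and [osc_slope] are linear in the amplitudes, so the differences are again of that
    form and the size estimates apply to them. *)
Lemma corr_slope_diff (M1 M2 e : R) (G1 G2 : R -> R) (x : R) :
  admissible D M1 G1 -> admissible D M2 G2 ->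
  (forall s, D s -> Rabs (G1 s - G2 s) <= e) -> D x ->
  Rabs (corr G1 x - corr G2 x) <= 2 / w * e * x^3 /\
  Rabs (slope G1 x - slope G2 x) <= (w + k) / w * e * x^4.
Proof.
  intros H1 H2 He Hx. pose proof frequency_pos as Hw.
  destruct (amp_diff _ _ _ _ _ _ H1 H2 He Hx) as [Hc Hs].
  destruct Hx as [Hx Hx'].
  set (al := fun y => amp_cos G1 y - amp_cos G2 y).
  set (be := fun y => amp_sin G1 y - amp_sin G2 y).
  replace (corr G1 x - corr G2 x) with (osc_value w k al be x)
    by (unfold corr, osc_value, al, be; ring).
  replace (slope G1 x - slope G2 x) with (osc_slope w k al be x)
    by (unfold slope, osc_slope, al, be, Rdiv; ring).
  split.
  - replace (2 / w * e) with (2 * (e / w)) by (field; lra).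
    apply osc_value_le; assumption.
  - replace ((w + k) / w * e) with ((w + k) * (e / w)) by (field; lra).
    apply osc_slope_le; try assumption; unfold k; lra.
Qed.

Lemma corr_slope_le (M : R) (G : R -> R) (x : R) :
  admissible D M G -> D x ->
  Rabs (corr G x) <= 2 / w * M * x^3 /\
  Rabs (slope G x) <= (w + k) / w * M * x^4.
Proof.
  intros HG Hx. pose proof frequency_pos as Hw.
  assert (H0 : admissible D 0 (fun _ => 0)).
  { intros s _. split; [apply continuous_const|rewrite Rabs_R0; lra]. }
  assert (Hd : forall s, D s -> Rabs (G s - 0) <= M).
  { intros s Hs. rewrite Rminus_0_r. apply HG, Hs. }
  pose proof (corr_slope_diff _ _ _ _ _ x HG H0 Hd Hx) as H.
  assert (Hc : amp_cos (fun _ => 0) x = 0).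
  { unfold amp_cos. rewrite weighted_primitive_0; [unfold Rdiv; ring|].
    intros; apply Rmult_0_r. }
  assert (Hs : amp_sin (fun _ => 0) x = 0).
  { unfold amp_sin. rewrite weighted_primitive_0; [unfold Rdiv; ring|].
    intros; apply Rmult_0_r. }
  replace (corr (fun _ => 0) x) with 0 in H
    by (unfold corr, osc_value; rewrite Hc Hs; ring).
  replace (slope (fun _ => 0) x) with 0 in H
    by (unfold slope, osc_slope; rewrite Hc Hs; unfold Rdiv; ring).
  rewrite !Rminus_0_r in H. exact H.
Qed.

End Oscillator.

(** * The hodograph system *)

(* The fixed-point unknown [G] is the right-hand side of the oscillator
   equation [y'' + w^2 y = s^{k+4} G] (derivatives in [1/s]). *)
Definition source (a b d x eta h : R) : R :=
  ((1/2 + 2 * b) * (3/2 + 2 * b) * x^2 * eta + 4 * remainder a b d (x^2) eta h) / x^4.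

Lemma Rabs_div_le (y c z : R) : 0 < z -> Rabs y <= c * z -> Rabs (y / z) <= c.
Proof.
  intros Hz Hy. unfold Rdiv. rewrite Rabs_mult Rabs_inv (Rabs_pos_eq z); [|lra].
  apply (Rmult_le_reg_r z); [exact Hz|]. rewrite Rmult_assoc Rinv_l; lra.
Qed.

(** Both parts of the numerator have Lipschitz constant [O(x^2)], so division by [x^4] loses
    [x^(-2)]; the gains [x^3] and [x^4] of [corr] and [slope] outweigh this. *)
Lemma source_diff (a b d x eta h eta' h' : R) :
  0 <= b -> 0 < x <= 1 -> (1 + Rabs a + Rabs d) * x <= 1 ->
  Rabs eta <= x^2 -> Rabs h <= x^2 -> Rabs eta' <= x^2 -> Rabs h' <= x^2 ->
  Rabs (source a b d x eta h - source a b d x eta' h')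
    <= ((1/2 + 2 * b) * (3/2 + 2 * b) + 180 * b * (1 + Rabs a + Rabs d))
       * (Rabs (eta - eta') + Rabs (h - h')) / x^2.
Proof.
  intros Hb Hx HK H1 H2 H3 H4. unfold source.
  pose proof (Rabs_pos a). pose proof (Rabs_pos d).
  assert (HK2 : (1 + Rabs a + Rabs d) * x^2 <= 1) by (simpl; nra).
  pose proof (remainder_lipschitz a b d (x^2) eta h eta' h' Hb ltac:(nra) HK2 H1 H2 H3 H4) as H5.
  set (c := (1/2 + 2 * b) * (3/2 + 2 * b)) in *.
  assert (Hc : 0 <= c) by (unfold c; nra).
  replace ((c * x^2 * eta + 4 * remainder a b d (x^2) eta h) / x^4
           - (c * x^2 * eta' + 4 * remainder a b d (x^2) eta' h') / x^4)
    with ((c * x^2 * (eta - eta')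
           + 4 * (remainder a b d (x^2) eta h - remainder a b d (x^2) eta' h')) / x^4)
    by (field; lra).
  apply Rabs_div_le; [apply pow_lt; lra|].
  eapply Rle_trans; [apply Rabs_triang|].
  rewrite (Rabs_mult (c * x^2)) (Rabs_mult 4) (Rabs_pos_eq 4) ?(Rabs_pos_eq (c * x^2)); try nra.
  replace ((c + 180 * b * (1 + Rabs a + Rabs d)) * (Rabs (eta - eta') + Rabs (h - h')) / x^2 * x^4)
    with ((c + 180 * b * (1 + Rabs a + Rabs d)) * (Rabs (eta - eta') + Rabs (h - h')) * x^2)
    by (field; lra).
  assert (0 <= c * x^2 * Rabs (h - h')).
  { pose proof (Rabs_pos (h - h')). repeat apply Rmult_le_pos; nra. }
  nra.
Qed.

(** The bound [O(e^2) = O(x^4)] on [remainder] exactly balances the division by [x^4]; this is the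
    purpose of subtracting [d/v]. *)
Lemma source_at_0 (a b d x : R) :
  0 <= b -> 0 < x <= 1 -> (1 + Rabs a + Rabs d) * x <= 1 -> b * d = a + 2 * a * b ->
  Rabs (source a b d x 0 0)
    <= 4 * (2 * Rabs d + b * (2 * Rabs d + 90 * (1 + Rabs a + Rabs d)^2)).
Proof.
  intros Hb Hx HK Hd. unfold source.
  pose proof (Rabs_pos a). pose proof (Rabs_pos d).
  assert (HK2 : (1 + Rabs a + Rabs d) * x^2 <= 1) by (simpl; nra).
  pose proof (remainder_at_0 a b d (x^2) Hb ltac:(nra) HK2 Hd).
  rewrite Rmult_0_r Rplus_0_l. apply Rabs_div_le; [apply pow_lt; lra|].
  rewrite Rabs_mult (Rabs_pos_eq 4); [|lra].
  replace (x^4) with ((x^2)^2) by ring. lra.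
Qed.

(* Here [s = v^{-1/2}], so [d/ds = - 2 s^{-3} d/dv]. *)
Lemma hodograph_solution (a b : R) :
  0 < b ->
  exists (s0 C : R) (Z P : R -> R), 0 < s0 <= 1 /\
    forall s, 0 < s < s0 ->
      is_derive Z s (- 2 * (P s - 1 - a * s^2) / s^3) /\
      is_derive P s (- 2 * b / s * ((P s)^3 * exp (- Z s) - P s)) /\
      Rabs (Z s) <= C * s^2 /\ 1 / 2 <= P s.
Proof.
  intros Hb.
  set (d := (a + 2 * a * b) / b).
  assert (Hd : b * d = a + 2 * a * b) by (unfold d; field; lra).
  set (w := 2 * sqrt b). set (k := 1/2 + 2 * b).
  assert (Hw : 0 < w) by (apply frequency_pos; exact Hb).
  set (K := 1 + Rabs a + Rabs d).
  assert (HK : 1 <= K) by (unfold K; pose proof (Rabs_pos a); pose proof (Rabs_pos d); lra).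
  set (A := 2 / w). set (B := (w + k) / w).
  assert (HA : 0 < A) by (apply Rdiv_lt_0_compat; lra).
  assert (HB : 0 < B) by (apply Rdiv_lt_0_compat; unfold k; lra).
  set (C0 := 4 * (2 * Rabs d + b * (2 * Rabs d + 90 * K^2))).
  assert (HC0 : 0 <= C0).
  { unfold C0. pose proof (Rabs_pos d).
    assert (0 <= b * (2 * Rabs d + 90 * K^2)) by (apply Rmult_le_pos; nra). lra. }
  (* [T] maps the ball to itself once [M/2 + C0 <= M]. *)
  set (M := 2 * C0 + 1).
  set (L := (1/2 + 2 * b) * (3/2 + 2 * b) + 180 * b * K).
  assert (HL : 0 < L) by (unfold L; nra).
  (* On [x < 1/Q] all smallness conditions hold: [A M] and [B M] keep [corr] and [slope] below
     [x^2], [2K] serves the remainder estimates and [P >= 1/2], and [2L(A + B)] gives the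
     contraction factor 1/2. *)
  set (Q := 1 + A * M + B * M + 2 * K + 2 * L * (A + B)).
  assert (HAM : 0 < A * M) by (apply Rmult_lt_0_compat; unfold M; lra).
  assert (HBM : 0 < B * M) by (apply Rmult_lt_0_compat; unfold M; lra).
  assert (HLAB : 0 < L * (A + B)) by (apply Rmult_lt_0_compat; lra).
  assert (HQ : 1 <= Q) by (unfold Q; lra).
  set (s0 := / Q).
  assert (Hs0 : 0 < s0 <= 1).
  { unfold s0. split; [apply Rinv_0_lt_compat; lra|].
    rewrite -Rinv_1. apply Rinv_le_contravar; lra. }
  assert (Hsmall : forall c x, 0 < x < s0 -> c <= Q -> c * x <= 1).
  { intros c x [Hx0 Hx] Hc.
    apply Rle_trans with (Q * / Q); [|right; apply Rinv_r; lra].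
    apply Rle_trans with (Q * x); [apply Rmult_le_compat_r; lra|].
    apply Rmult_le_compat_l; [lra|left; exact Hx]. }
  set (D := fun s => 0 < s < s0).
  set (T := fun G x => source a b d x (corr b G x) (slope b G x)).
  assert (Hsq : forall G x, admissible D M G -> D x ->
            Rabs (corr b G x) <= x^2 /\ Rabs (slope b G x) <= x^2).
  { intros G x HG Hx.
    destruct (corr_slope_le b s0 Hb Hs0 M G x HG Hx) as [H1 H2].
    fold w k in H1, H2. fold A in H1. fold B in H2.
    pose proof (Hsmall (A * M) x Hx ltac:(unfold Q; lra)).
    pose proof (Hsmall (B * M) x Hx ltac:(unfold Q; lra)).
    destruct Hx as [Hx0 Hx1].
    assert (x^4 <= x^3).
    { replace (x^4) with (x * x^3) by ring. replace (x^3) with (1 * x^3) at 2 by ring.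
      apply Rmult_le_compat_r; [apply pow_le|]; lra. }
    assert (0 < x^2) by (apply pow_lt; lra).
    split.
    - replace (A * M * x^3) with (A * M * x * x^2) in H1 by ring.
      assert (A * M * x * x^2 <= 1 * x^2) by (apply Rmult_le_compat_r; lra). lra.
    - assert (B * M * x^4 <= B * M * x * x^2).
      { replace (B * M * x * x^2) with (B * M * x^3) by ring.
        apply Rmult_le_compat_l; lra. }
      assert (B * M * x * x^2 <= 1 * x^2) by (apply Rmult_le_compat_r; lra). lra. }
  (* Stated for arbitrary values rather than for [T], so that it also compares with [eta = h = 0] in
     the self-map estimate. *)
  assert (HdiffT : forall x eta h eta' h' e, D x ->
     Rabs eta <= x^2 -> Rabs h <= x^2 -> Rabs eta' <= x^2 -> Rabs h' <= x^2 ->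
     Rabs (eta - eta') <= A * e * x^3 -> Rabs (h - h') <= B * e * x^4 ->
     Rabs (source a b d x eta h - source a b d x eta' h') <= e / 2).
  { intros x eta h eta' h' e Hx E1 E2 E3 E4 E5 E6.
    pose proof (Hsmall K x Hx ltac:(unfold Q; lra)) as HKx.
    pose proof (Hsmall (2 * L * (A + B)) x Hx ltac:(unfold Q; lra)) as HLx.
    destruct Hx as [Hx0 Hx1].
    eapply Rle_trans; [apply source_diff; try assumption; lra|].
    fold K L.
    assert (Hx2 : 0 < x^2) by (apply pow_lt; lra).
    assert (Hx3 : 0 < x^3) by (apply pow_lt; lra).
    assert (He : 0 <= e).
    { assert (0 <= A * e * x^3) by (eapply Rle_trans; [apply Rabs_pos|exact E5]).
      apply Rnot_lt_le. intros Hn.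
      assert (0 < A * x^3) by (apply Rmult_lt_0_compat; lra). nra. }
    apply Rle_trans with (L * (A * e * x^3 + B * e * x^3) / x^2).
    - apply Rmult_le_compat_r; [left; apply Rinv_0_lt_compat; lra|].
      apply Rmult_le_compat_l; [lra|]. apply Rplus_le_compat; [lra|].
      eapply Rle_trans; [exact E6|].
      replace (B * e * x^4) with (B * e * x^3 * x) by ring.
      rewrite -{2}(Rmult_1_r (B * e * x^3)). apply Rmult_le_compat_l; [|lra].
      apply Rmult_le_pos; [apply Rmult_le_pos|]; lra.
    - replace (L * (A * e * x^3 + B * e * x^3) / x^2) with (2 * L * (A + B) * x * (e / 2))
        by (field; lra).
      nra. }
  assert (HTadm : forall G, admissible D M G -> admissible D M (T G)).
  { intros G HG x Hx. destruct (Hsq G x HG Hx) as [H1 H2]. split.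
    - pose proof (is_derive_corr b s0 Hb Hs0 M G x HG Hx) as Hc.
      pose proof (is_derive_slope b s0 Hb Hs0 M G x HG Hx) as Hs.
      apply: ex_derive_continuous. unfold T, source, remainder.
      revert Hc Hs. set (e := corr b G). set (h := slope b G). intros Hc Hs.
      destruct Hx as [Hx0 Hx1].
      assert (x * (x * (x * (x * 1))) <> 0) by (apply (pow_nonzero x 4); lra).
      auto_derive. repeat split; try (eexists; eassumption); assumption.
    - destruct (corr_slope_le b s0 Hb Hs0 M G x HG Hx) as [H3 H4].
      assert (H0 : Rabs 0 <= x^2) by (rewrite Rabs_R0; apply pow2_ge_0).
      pose proof (HdiffT x _ _ 0 0 M Hx H1 H2 H0 H0
         ltac:(rewrite Rminus_0_r; exact H3) ltac:(rewrite Rminus_0_r; exact H4)) as H5.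
      pose proof (source_at_0 a b d x ltac:(lra) ltac:(unfold D in Hx; lra)
        (Hsmall K x Hx ltac:(unfold Q; lra)) Hd) as H6.
      fold K in H6. fold C0 in H6. unfold T.
      replace (source a b d x (corr b G x) (slope b G x)) with
        ((source a b d x (corr b G x) (slope b G x) - source a b d x 0 0)
         + source a b d x 0 0) by ring.
      eapply Rle_trans; [apply Rabs_triang|]. unfold M in *. lra. }
  destruct (contraction_fixed_point D M T) as [G [HG Hfix]].
  - apply open_domain.
  - unfold M; lra.
  - exact HTadm.
  - intros G1 G2 e H1 H2 He x Hx.
    destruct (Hsq G1 x H1 Hx), (Hsq G2 x H2 Hx).
    destruct (corr_slope_diff b s0 Hb Hs0 M M e G1 G2 x H1 H2 He Hx).
    apply HdiffT; assumption.
  (* [Z = d/v + eta], and [P = 1 + a/v + Z_v] with [(d/v)_v = -d/v^2], all written with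
     [1/v = s^2]. *)
  - exists s0, (Rabs d + 1), (fun s => d * s^2 + corr b G s),
      (fun s => 1 + a * s^2 - d * s^4 + slope b G s).
    split; [exact Hs0|]. intros s Hs.
    destruct (Hsq G s HG Hs) as [H1 H2].
    pose proof (is_derive_corr b s0 Hb Hs0 M G s HG Hs) as Hc.
    pose proof (is_derive_slope b s0 Hb Hs0 M G s HG Hs) as Hsl.
    pose proof (Hfix s Hs) as HF. unfold T, source, remainder in HF.
    pose proof (Hsmall (2 * K) s Hs ltac:(unfold Q; lra)) as HKs.
    destruct Hs as [Hsp Hs1].
    (* Replacing [G] by [source], its term [k(k+1) s^2 eta] cancels the extra one in the derivative
       of [slope], leaving the nonlinear equation. *)
    rewrite HF in Hsl. clear HF.
    revert H1 H2 Hc Hsl. set (e := corr b G). set (h := slope b G). intros H1 H2 Hc Hsl.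
    split; [|split; [|split]].
    + auto_derive; [eexists; exact Hc|].
      rewrite (is_derive_unique (fun y => e y) _ _ Hc). field. lra.
    + auto_derive; [eexists; exact Hsl|].
      rewrite (is_derive_unique (fun y => h y) _ _ Hsl).
      replace (- (d * s^2 + e s)) with (- d * s^2 - e s) by ring.
      field. lra.
    + eapply Rle_trans; [apply Rabs_triang|].
      rewrite Rabs_mult (Rabs_pos_eq (s^2)); [|apply pow2_ge_0]. lra.
    + assert (Hs2 : s^2 <= s) by nra.
      assert (HP := Rabs_momentum_le a d (s^2) (h s) ltac:(nra) H2).
      fold K in HP. apply Rabs_le_between in HP.
      assert (K * s^2 <= K * s) by (apply Rmult_le_compat_l; lra).
      replace ((s^2)^2) with (s^4) in HP by ring. lra.
Qed.

(** * Inverting the hodograph transform *)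

Lemma is_derive_continuity_pt (f : R -> R) (x l : R) :
  is_derive f x l -> continuity_pt f x.
Proof.
  intros H. apply derivable_continuous_pt. exists l. apply is_derive_Reals, H.
Qed.

Section DecreasingInverse.

Variables (tau dtau : R -> R) (s0 : R).
Hypotheses (Hs0 : 0 < s0)
  (Hder : forall s, 0 < s < s0 -> is_derive tau s (dtau s))
  (Hneg : forall s, 0 < s < s0 -> dtau s < 0)
  (Hinf : forall M, exists s, 0 < s < s0 /\ M < tau s).

Lemma tau_decreasing (s s' : R) : 0 < s -> s < s' -> s' < s0 -> tau s' < tau s.
Proof.
  intros H1 H2 H3.
  destruct (MVT_gen tau s s' dtau) as [c [Hc E]].
  - intros x. rewrite Rmin_left ?Rmax_right; try lra. intros Hx. apply Hder; lra.
  - intros x. rewrite Rmin_left ?Rmax_right; try lra. intros Hx.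
    apply (is_derive_continuity_pt _ _ (dtau x)), Hder; lra.
  - rewrite Rmin_left ?Rmax_right in Hc; try lra.
    pose proof (Hneg c ltac:(lra)). nra.
Qed.

(** The intermediate value theorem needs a closed interval inside the domain; as nothing is assumed
    at the open end [s0], the base point is [s0 / 2]. *)
Lemma tau_surjective (t : R) :
  tau (s0 / 2) < t -> exists s, 0 < s < s0 / 2 /\ tau s = t.
Proof.
  intros Ht. destruct (Hinf t) as [s [Hs Hts]].
  assert (Hs2 : s < s0 / 2).
  { apply Rnot_le_lt. intros H. destruct (Req_dec s (s0 / 2)) as [->|Hne]; [lra|].
    pose proof (tau_decreasing (s0 / 2) s ltac:(lra) ltac:(lra) ltac:(lra)). lra. }
  destruct (Ranalysis5.IVT_interv (fun x => t - tau x) s (s0 / 2)) as [z [Hz E]]; try lra.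
  - intros x Hx. apply continuity_pt_minus; [apply continuity_pt_const; now intros ? ?|].
    apply (is_derive_continuity_pt _ _ (dtau x)), Hder; lra.
  - exists z. split; [|lra]. split; [lra|].
    destruct (Req_dec z (s0 / 2)) as [->|]; lra.
Qed.

Lemma decreasing_inverse :
  exists S : R -> R, forall t, tau (s0 / 2) < t ->
    0 < S t < s0 /\ tau (S t) = t /\ is_derive S t (/ dtau (S t)).
Proof.
  set (S := fun t => epsilon (inhabits 0) (fun s => 0 < s < s0 / 2 /\ tau s = t)).
  assert (HS : forall t, tau (s0 / 2) < t -> 0 < S t < s0 / 2 /\ tau (S t) = t).
  { intros t Ht. apply (epsilon_spec (inhabits 0) (fun s => 0 < s < s0 / 2 /\ tau s = t)).
    apply tau_surjective, Ht. }
  exists S. intros t Ht. destruct (HS t Ht) as [Hs Hts].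
  split; [lra|split; [exact Hts|]].
  set (s := S t) in *. set (m := dtau s).
  assert (Hm : m < 0) by (apply Hneg; lra).
  apply is_derive_Reals. intros eps Heps.
  (* The bound [-m/2] makes [tau] expanding near [s], giving [|m| |s' - s| <= 2 |h|]; the bound
     [eps m^2/4] then makes the quotient error smaller than [eps]. *)
  assert (He' : 0 < Rmin (- m / 2) (eps * m^2 / 4)).
  { apply Rmin_glb_lt; [lra|]. apply Rdiv_lt_0_compat; [|lra].
    apply Rmult_lt_0_compat; nra. }
  set (e' := Rmin (- m / 2) (eps * m^2 / 4)) in *.
  assert (Hl := proj2 (Hder s ltac:(lra)) s (fun P H => H) (mkposreal e' He')).
  destruct Hl as [dl Hdl]. simpl in Hdl.
  set (rho := Rmin (dl / 2) (Rmin (s / 2) ((s0 / 2 - s) / 2))).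
  assert (Hrho : 0 < rho /\ rho <= dl / 2 /\ rho <= s / 2 /\ rho <= (s0 / 2 - s) / 2).
  { pose proof (cond_pos dl). unfold rho. repeat split.
    - repeat apply Rmin_glb_lt; lra.
    - apply Rmin_l.
    - eapply Rle_trans; [apply Rmin_r|apply Rmin_l].
    - eapply Rle_trans; [apply Rmin_r|apply Rmin_r]. }
  destruct Hrho as [R0 [R1 [R2 R3]]].
  pose proof (tau_decreasing (s - rho) s ltac:(lra) ltac:(lra) ltac:(lra)) as HL.
  pose proof (tau_decreasing s (s + rho) ltac:(lra) ltac:(lra) ltac:(lra)) as HR.
  (* For such increments [t + h] lies between [tau (s + rho)] and [tau (s - rho)], so monotonicity
     forces [|s' - s| <= rho]: this is the continuity of the inverse. *)
  assert (Hd : 0 < Rmin (t - tau (s0 / 2)) (Rmin (tau (s - rho) - t) (t - tau (s + rho)))).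
  { repeat apply Rmin_glb_lt; lra. }
  exists (mkposreal _ Hd). simpl. intros h Hh0 Hh.
  pose proof (Rmin_l (t - tau (s0 / 2)) (Rmin (tau (s - rho) - t) (t - tau (s + rho)))) as M1.
  pose proof (Rmin_r (t - tau (s0 / 2)) (Rmin (tau (s - rho) - t) (t - tau (s + rho)))) as M2.
  pose proof (Rmin_l (tau (s - rho) - t) (t - tau (s + rho))) as M3.
  pose proof (Rmin_r (tau (s - rho) - t) (t - tau (s + rho))) as M4.
  apply Rabs_lt_between in Hh.
  destruct (HS (t + h) ltac:(lra)) as [Hs' Hts'].
  set (s' := S (t + h)) in *.
  assert (Hclose : Rabs (s' - s) <= rho).
  { apply Rabs_le. split; apply Rnot_lt_le; intros Hc.
    - pose proof (tau_decreasing s' (s - rho) ltac:(lra) ltac:(lra) ltac:(lra)). lra.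
    - pose proof (tau_decreasing (s + rho) s' ltac:(lra) ltac:(lra) ltac:(lra)). lra. }
  assert (Hb : ball s dl s').
  { change (Rabs (s' - s) < dl). pose proof (cond_pos dl). lra. }
  specialize (Hdl s' Hb).
  change (Rabs (tau s' - tau s - (s' - s) * dtau s) <= e' * Rabs (s' - s)) in Hdl.
  rewrite Hts' Hts in Hdl. fold m in Hdl.
  replace (t + h - t - (s' - s) * m) with (h - (s' - s) * m) in Hdl by ring.
  pose proof (Rmin_l (- m / 2) (eps * m^2 / 4)) as E1. fold e' in E1.
  pose proof (Rmin_r (- m / 2) (eps * m^2 / 4)) as E2. fold e' in E2.
  pose proof (Rabs_pos (s' - s)) as Hp.
  assert (Hlip : - m * Rabs (s' - s) <= 2 * Rabs h).
  { assert (Rabs ((s' - s) * m) <= Rabs h + Rabs (h - (s' - s) * m)).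
    { replace ((s' - s) * m) with (h - (h - (s' - s) * m)) at 1 by ring.
      eapply Rle_trans; [apply Rabs_triang|]. rewrite Rabs_Ropp. lra. }
    rewrite Rabs_mult (Rabs_left m Hm) in H.
    assert (e' * Rabs (s' - s) <= - m / 2 * Rabs (s' - s)) by (apply Rmult_le_compat_r; lra).
    lra. }
  change (Rabs ((s' - s) / h - / m) < eps).
  replace ((s' - s) / h - / m) with (- (h - (s' - s) * m) / (h * m)) by (field; lra).
  unfold Rdiv. rewrite Rabs_mult Rabs_Ropp Rabs_inv Rabs_mult (Rabs_left m Hm).
  assert (Hh1 : 0 < Rabs h) by (apply Rabs_pos_lt; exact Hh0).
  apply (Rmult_lt_reg_r (Rabs h * - m)); [nra|].
  rewrite Rmult_assoc Rinv_l; [|nra]. rewrite Rmult_1_r.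
  eapply Rle_lt_trans; [exact Hdl|].
  apply Rle_lt_trans with (eps * m^2 / 4 * Rabs (s' - s)); [apply Rmult_le_compat_r; lra|].
  replace (eps * m^2 / 4 * Rabs (s' - s)) with (eps * - m / 4 * (- m * Rabs (s' - s))) by field.
  apply Rle_lt_trans with (eps * - m / 4 * (2 * Rabs h)).
  - apply Rmult_le_compat_l; [nra|exact Hlip].
  - assert (0 < eps * - m * Rabs h) by (repeat apply Rmult_lt_0_compat; lra). lra.
Qed.

End DecreasingInverse.

Lemma emden_ode_solution (q r : R) :
  1 < q ->
  exists (W W1 W2 : R -> R) (t0 C : R),
    (forall t, t0 < t ->
      is_derive W t (W1 t) /\ is_derive W1 t (W2 t) /\ continuous W2 t /\ 0 < W t /\
      - 4 * exp t * W2 t = Rpower (W t) r * exp (Rpower (W t) q) /\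
      Rabs (t - (Rpower (W t) q + (2 * q + r - 1) / q * ln (Rpower (W t) q)
                 - ln (4 * (q - 1) / q^2))) <= C / Rpower (W t) q) /\
    (forall M, exists t1, forall t, t1 < t -> t0 < t -> M < Rpower (W t) q).
Proof.
  intros Hq.
  set (a := (2 * q + r - 1) / q). set (b := 1 - 1 / q).
  set (c := ln (4 * (q - 1) / q^2)).
  assert (Hiq : 0 < 1 / q < 1).
  { split; [apply Rdiv_lt_0_compat; lra|]. apply (Rmult_lt_reg_r q); [lra|].
    replace (1 / q * q) with 1 by (field; lra). lra. }
  assert (Hb : 0 < b) by (unfold b; lra).
  destruct (hodograph_solution a b Hb) as [s0 [C [Z [P [Hs0 H]]]]].
  (* This is [t = v + a ln v - c + Z] at [v = s^(-2)]. *)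
  set (tau := fun s => / s^2 - 2 * a * ln s - c + Z s).
  set (dtau := fun s => - 2 * P s / s^3).
  assert (Hder : forall s, 0 < s < s0 -> is_derive tau s (dtau s)).
  { intros s Hs. destruct (H s Hs) as [HZ _]. unfold tau, dtau.
    assert (s * (s * 1) <> 0) by (apply (pow_nonzero s 2); lra).
    auto_derive; [repeat split; try (eexists; exact HZ); try assumption; lra|].
    rewrite (is_derive_unique (fun y => Z y) _ _ HZ). field. lra. }
  assert (Hneg : forall s, 0 < s < s0 -> dtau s < 0).
  { intros s Hs. destruct (H s Hs) as [_ [_ [_ HP]]]. unfold dtau.
    assert (0 < s^3) by (apply pow_lt; lra).
    assert (0 < 2 * P s / s^3) by (apply Rdiv_lt_0_compat; lra).
    replace (- 2 * P s / s^3) with (- (2 * P s / s^3)) by (field; lra). lra. }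
  (* [ln s >= - 1 / s] since [1 + x <= exp x] at [x = - ln s]. *)
  assert (Htau : forall s, 0 < s < s0 -> / s^2 - 2 * Rabs a * / s - Rabs c - Rabs C <= tau s).
  { intros s Hs. destruct (H s Hs) as [_ [_ [HZ _]]]. unfold tau.
    assert (Hln : Rabs (ln s) <= / s).
    { rewrite Rabs_left1; [|rewrite -ln_1; apply ln_le; lra].
      pose proof (exp_ineq1_le (- ln s)) as He. rewrite exp_Ropp exp_ln in He; lra. }
    assert (H1 : Rabs (2 * a * ln s) <= 2 * Rabs a * / s).
    { rewrite (Rabs_mult (2 * a)) (Rabs_mult 2) (Rabs_pos_eq 2); [|lra]. apply Rmult_le_compat_l; [|exact Hln].
      pose proof (Rabs_pos a); lra. }
    assert (HC : Rabs (Z s) <= Rabs C).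
    { eapply Rle_trans; [exact HZ|]. pose proof (Rle_abs C). pose proof (Rabs_pos C).
      assert (0 <= s^2 <= 1) by nra. nra. }
    apply Rabs_le_between in H1, HC. pose proof (Rle_abs c). lra. }
  assert (Hinf : forall M, exists s, 0 < s < s0 /\ M < tau s).
  { intros M.
    (* At [s = 1/y] the lower bound is [y (y - 2|a|) - |c| - |C|]. The term [2 / s0] puts [1/y]
       inside the interval and makes [y >= 1]. *)
    set (y := 2 * Rabs a + Rabs c + Rabs C + Rabs M + 2 * / s0).
    pose proof (Rabs_pos a). pose proof (Rabs_pos c). pose proof (Rabs_pos C).
    pose proof (Rabs_pos M).
    assert (Hi : 1 <= / s0) by (rewrite -Rinv_1; apply Rinv_le_contravar; lra).
    assert (Hy : 0 < y) by (unfold y; lra).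
    exists (/ y).
    assert (Hs : 0 < / y < s0).
    { split; [apply Rinv_0_lt_compat; lra|]. rewrite -(Rinv_inv s0).
      apply Rinv_lt_contravar; [apply Rmult_lt_0_compat; lra|unfold y; lra]. }
    split; [exact Hs|]. eapply Rlt_le_trans; [|apply Htau, Hs].
    rewrite -pow_inv !Rinv_inv. pose proof (Rle_abs M).
    assert (y * (y - 2 * Rabs a) >= 1 * (y - 2 * Rabs a)).
    { apply Rmult_ge_compat_r; unfold y; lra. }
    unfold y in *. nra. }
  destruct (decreasing_inverse tau dtau s0 (proj1 Hs0) Hder Hneg Hinf) as [S HS].
  set (Y := fun s => Rpower s (- 2 / q)).
  assert (HYpow : forall s p, 0 < s -> Rpower (Y s) p = Rpower s (- 2 / q * p)).
  { intros s p Hs. unfold Y. apply Rpower_mult. }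
  assert (HYq : forall s, 0 < s -> Rpower (Y s) q = / s^2).
  { intros s Hs. rewrite HYpow //. replace (- 2 / q * q) with (- INR 2) by (simpl; field; lra).
    rewrite Rpower_Ropp Rpower_pow //. }
  (* [W = v^(1/q)] and [W' = W_v / P]. In [W''] the equation for [P_v] eliminates every [P], so
     continuity of [W''] follows from that of [S] and [Z]. *)
  exists (fun t => Y (S t)), (fun t => (1 - b) * (S t)^2 * Y (S t) / P (S t)),
    (fun t => - b * (1 - b) * (S t)^4 * Y (S t) * exp (- Z (S t))), (tau (s0 / 2)), C.
  split.
  - intros t Ht. destruct (HS t Ht) as [Hs [Hts HdS]].
    destruct (H (S t) Hs) as [HZ [HP [HZb HPb]]].
    assert (HEZ : ex_derive (fun x => Z x) (S t)) by (eexists; exact HZ).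
    assert (HEP : ex_derive (fun x => P x) (S t)) by (eexists; exact HP).
    assert (HES : ex_derive (fun x => S x) t) by (eexists; exact HdS).
    pose proof (is_derive_unique (fun x => Z x) _ _ HZ) as UZ.
    pose proof (is_derive_unique (fun x => P x) _ _ HP) as UP.
    pose proof (is_derive_unique (fun x => S x) _ _ HdS) as US.
    set (s := S t) in *.
    assert (Hb1 : 1 - b = 1 / q) by (unfold b; ring).
    rewrite (HYq s); [|lra].
    split; [|split; [|split; [|split; [|split]]]].
    + unfold Y, Rpower. auto_derive; [repeat split; try assumption; fold s; lra|].
      rewrite US. fold s. unfold dtau. rewrite Hb1. field. lra.
    + unfold Y, Rpower. auto_derive; [repeat split; try assumption; fold s; lra|].
      rewrite US UP. fold s. unfold dtau. rewrite Hb1. unfold b. field. lra.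
    + apply: ex_derive_continuous. unfold Y, Rpower.
      auto_derive. repeat split; try assumption. fold s; lra.
    + apply Rpower_gt0.
    + rewrite HYpow; [|lra].
      replace (exp t) with (exp (/ s^2) * Rpower s (- 2 * a) * (q^2 / (4 * (q - 1))) * exp (Z s)).
      2:{ rewrite -Hts. unfold tau. fold s.
          replace (/ s^2 - 2 * a * ln s - c + Z s) with (/ s^2 + (- 2 * a) * ln s + - c + Z s) by ring.
          rewrite !exp_plus exp_Ropp. unfold c. rewrite exp_ln; [|apply Rdiv_lt_0_compat; nra].
          unfold Rpower. field. lra. }
      (* The identity [r/q = a - 2 + 1/q] in powers of [v = s^(-2)]; it determines [a]. *)
      replace (Rpower s (- 2 / q * r)) with (Rpower s (- 2 * a) * s^4 * Y s).
      2:{ unfold Y. rewrite -(Rpower_pow 4); [|lra]. rewrite -!Rpower_plus. f_equal.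
          unfold a. simpl. field. lra. }
      rewrite Hb1 exp_Ropp. pose proof (exp_pos (Z s)). unfold b. field. lra.
    + rewrite ln_Rinv; [|nra].
      replace (ln (s^2)) with (2 * ln s) by (rewrite -Rpower_pow; [|lra]; rewrite ln_Rpower //).
      replace (t - (/ s^2 + a * - (2 * ln s) - c)) with (Z s)
        by (rewrite -Hts; unfold tau; ring).
      unfold Rdiv. rewrite Rinv_inv. exact HZb.
  - intros M.
    (* As [s < 1/(|M| + 1) <= 1], also [s^2 < 1/(|M| + 1)], hence [v > M]. *)
    set (dl := Rmin (s0 / 2) (/ (Rabs M + 1))).
    pose proof (Rabs_pos M).
    assert (HM : 0 < / (Rabs M + 1)) by (apply Rinv_0_lt_compat; lra).
    assert (HM1 : / (Rabs M + 1) <= 1) by (rewrite -Rinv_1; apply Rinv_le_contravar; lra).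
    assert (Hdl : 0 < dl <= s0 / 2).
    { unfold dl. split; [apply Rmin_glb_lt; lra|apply Rmin_l]. }
    exists (tau dl). intros t Ht Ht0. destruct (HS t Ht0) as [Hs [Hts _]].
    rewrite HYq; [|lra].
    assert (Hlt : S t < dl).
    { apply Rnot_le_lt. intros [Hlt|Heq]; [|rewrite Heq in Ht; lra].
      pose proof (tau_decreasing tau dtau s0 Hder Hneg dl (S t)
        ltac:(lra) Hlt ltac:(lra)). lra. }
    assert (dl <= / (Rabs M + 1)) by apply Rmin_r.
    assert (S t ^ 2 < / (Rabs M + 1)) by nra.
    apply Rlt_le_trans with (Rabs M + 1); [pose proof (Rle_abs M); lra|].
    rewrite -(Rinv_inv (Rabs M + 1)). left. apply Rinv_lt_contravar; [|assumption].
    apply Rmult_lt_0_compat; [apply pow_lt; lra|exact HM].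
Qed.

(** * Radial functions in the plane *)

(** [ex_diff_n] speaks of [Derive]; it is stable under local equality, so explicit partial
    derivatives valid near the point may replace it. *)
Lemma ex_diff_n_S (f fx fy : R -> R -> R) (n : nat) (x y : R) :
  continuity_2d_pt f x y ->
  locally_2d (fun u v => is_derive (fun z => f z v) u (fx u v)) x y ->
  locally_2d (fun u v => is_derive (fun z => f u z) v (fy u v)) x y ->
  ex_diff_n fx n x y -> ex_diff_n fy n x y -> ex_diff_n f (S n) x y.
Proof.
  intros Hc Hx Hy Hfx Hfy. split; [exact Hc|]. split; [|split; [|split]].
  - eexists. exact (locally_2d_singleton _ _ _ Hx).
  - eexists. exact (locally_2d_singleton _ _ _ Hy).
  - apply: ex_diff_n_ext_loc Hfx. apply: locally_2d_impl Hx.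
    apply locally_2d_forall. intros u v H. symmetry. apply is_derive_unique, H.
  - apply: ex_diff_n_ext_loc Hfy. apply: locally_2d_impl Hy.
    apply locally_2d_forall. intros u v H. symmetry. apply is_derive_unique, H.
Qed.

Section Radial.

Variables (W W1 W2 : R -> R) (t0 : R).
Hypotheses
  (HW : forall t, t0 < t -> is_derive W t (W1 t))
  (HW1 : forall t, t0 < t -> is_derive W1 t (W2 t))
  (HW2 : forall t, t0 < t -> continuous W2 t).

Let T (x y : R) := - ln (x^2 + y^2).
Let D (x y : R) := 0 < x^2 + y^2 /\ t0 < T x y.

Definition radial (x y : R) : R := W (- ln (x^2 + y^2)).
Let ux (x y : R) := W1 (T x y) * (- 2 * x * / (x^2 + y^2)).
Let uy (x y : R) := W1 (T x y) * (- 2 * y * / (x^2 + y^2)).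
Let uxx (x y : R) := (W2 (T x y) + W1 (T x y)) * (4 * x * x * / (x^2 + y^2)^2)
   - 2 * W1 (T x y) * / (x^2 + y^2).
Let uxy (x y : R) := (W2 (T x y) + W1 (T x y)) * (4 * x * y * / (x^2 + y^2)^2).
Let uyy (x y : R) := (W2 (T x y) + W1 (T x y)) * (4 * y * y * / (x^2 + y^2)^2)
   - 2 * W1 (T x y) * / (x^2 + y^2).

Lemma radial_partials (x y : R) : D x y ->
  is_derive (fun z => radial z y) x (ux x y) /\
  is_derive (fun z => radial x z) y (uy x y) /\
  is_derive (fun z => ux z y) x (uxx x y) /\
  is_derive (fun z => ux x z) y (uxy x y) /\
  is_derive (fun z => uy z y) x (uxy x y) /\
  is_derive (fun z => uy x z) y (uyy x y).
Proof.
  intros [Hn Ht].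
  pose proof (HW _ Ht) as d0. pose proof (HW1 _ Ht) as d1. unfold T in *.
  assert (e0 : ex_derive (fun t => W t) (- ln (x^2 + y^2))) by (eexists; exact d0).
  assert (e1 : ex_derive (fun t => W1 t) (- ln (x^2 + y^2))) by (eexists; exact d1).
  assert (v0 := is_derive_unique (fun t => W t) _ _ d0).
  assert (v1 := is_derive_unique (fun t => W1 t) _ _ d1).
  unfold radial, ux, uy, uxx, uxy, uyy, T.
  split; [|split; [|split; [|split; [|split]]]]; auto_derive; simpl in *;
    try (repeat split; try assumption; lra); rewrite ?v0 ?v1; field; lra.
Qed.

Lemma continuity_2d_pt_sq (x y : R) : continuity_2d_pt (fun u v => u^2 + v^2) x y.
Proof.
  apply continuity_2d_pt_plus; simpl;
    repeat apply continuity_2d_pt_mult;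
    auto using continuity_2d_pt_id1, continuity_2d_pt_id2, continuity_2d_pt_const.
Qed.

Lemma continuity_2d_pt_of_T (g : R -> R) (x y : R) :
  0 < x^2 + y^2 -> continuous g (T x y) -> continuity_2d_pt (fun u v => g (T u v)) x y.
Proof.
  intros Hn Hg. apply continuity_1d_2d_pt_comp; [apply continuity_pt_filterlim, Hg|].
  apply continuity_2d_pt_opp.
  apply (continuity_1d_2d_pt_comp ln (fun u v => u^2 + v^2)); [|apply continuity_2d_pt_sq].
  apply (is_derive_continuity_pt _ _ (/ (x^2 + y^2))), is_derive_ln, Hn.
Qed.

Lemma radial_domain_open (x y : R) : D x y -> locally_2d D x y.
Proof.
  intros [Hn Ht]. apply locally_2d_and; apply locally_2d_locally.
  - apply (proj1 (continuity_2d_pt_filterlim (fun u v => u^2 + v^2) x y)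
      (continuity_2d_pt_sq x y) (fun z => 0 < z)), open_gt, Hn.
  - apply (proj1 (continuity_2d_pt_filterlim T x y)
      (continuity_2d_pt_of_T (fun t => t) x y Hn (continuous_id _)) (fun z => t0 < z)),
      open_gt, Ht.
Qed.

Lemma radial_C2 (x y : R) : D x y -> ex_diff_n radial 2 x y.
Proof.
  intros HD. pose proof (radial_domain_open x y HD) as Hloc.
  assert (Hl : forall Q : R -> R -> Prop, (forall u v, D u v -> Q u v) -> locally_2d Q x y).
  { intros Q HQ. apply: locally_2d_impl Hloc. apply locally_2d_forall. exact HQ. }
  destruct HD as [Hn Ht].
  assert (Hder : forall (g : R -> R) (l : R), is_derive g (T x y) l -> continuous g (T x y)).
  { intros g l Hg. apply: ex_derive_continuous. eexists. exact Hg. }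
  assert (c0 : continuity_2d_pt radial x y).
  { apply continuity_2d_pt_of_T; [exact Hn|]. eapply Hder, HW, Ht. }
  assert (c1 : continuity_2d_pt (fun u v => W1 (T u v)) x y).
  { apply continuity_2d_pt_of_T; [exact Hn|]. eapply Hder, HW1, Ht. }
  assert (c2 : continuity_2d_pt (fun u v => W2 (T u v)) x y).
  { apply continuity_2d_pt_of_T; [exact Hn|]. apply HW2, Ht. }
  assert (ci : continuity_2d_pt (fun u v => / (u^2 + v^2)) x y).
  { apply continuity_2d_pt_inv; [apply continuity_2d_pt_sq|lra]. }
  assert (ci2 : continuity_2d_pt (fun u v => / (u^2 + v^2)^2) x y).
  { apply (continuity_2d_pt_ext (fun u v => / (u^2 + v^2) * / (u^2 + v^2))).
    - intros u v. rewrite -Rinv_mult. f_equal. ring.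
    - apply continuity_2d_pt_mult; assumption. }
  apply (ex_diff_n_S _ ux uy); [exact c0|apply Hl; intros; now apply radial_partials..| |].
  - apply (ex_diff_n_S _ uxx uxy); [|apply Hl; intros; now apply radial_partials..| |];
      try split; try exact I; unfold ux, uxx, uxy;
      repeat (apply continuity_2d_pt_minus || apply continuity_2d_pt_mult
        || apply continuity_2d_pt_plus);
      auto using continuity_2d_pt_id1, continuity_2d_pt_id2, continuity_2d_pt_const.
  - apply (ex_diff_n_S _ uxy uyy); [|apply Hl; intros; now apply radial_partials..| |];
      try split; try exact I; unfold uy, uxy, uyy;
      repeat (apply continuity_2d_pt_minus || apply continuity_2d_pt_mult
        || apply continuity_2d_pt_plus);
      auto using continuity_2d_pt_id1, continuity_2d_pt_id2, continuity_2d_pt_const.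
Qed.

(** In the plane [T] is harmonic off the origin, so the [W1] terms cancel; the squared gradient of
    [T] is [4/|x|^2 = 4 e^T]. *)
Lemma radial_laplacian (x y : R) : D x y -> laplacian radial x y = 4 * exp (T x y) * W2 (T x y).
Proof.
  intros HD. pose proof (radial_domain_open x y HD) as Hloc.
  unfold laplacian, partial_derive. simpl.
  rewrite (Derive_ext_loc _ (fun z => ux z y) x).
  2:{ generalize (locally_2d_1d_const_y _ _ _ Hloc). apply filter_imp. intros u Hu.
      apply is_derive_unique. now apply radial_partials. }
  rewrite (Derive_ext_loc _ (fun z => uy x z) y).
  2:{ generalize (locally_2d_1d_const_x _ _ _ Hloc). apply filter_imp. intros u Hu.
      apply is_derive_unique. now apply radial_partials. }
  destruct (radial_partials x y HD) as [_ [_ [Hxx [_ [_ Hyy]]]]].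
  rewrite (is_derive_unique _ _ _ Hxx) (is_derive_unique _ _ _ Hyy).
  destruct HD as [Hn Ht]. unfold uxx, uyy.
  replace (exp (T x y)) with (/ (x^2 + y^2)) by (unfold T; rewrite exp_Ropp exp_ln; auto).
  field. lra.
Qed.

End Radial.

(** * Asymptotics *)

(** [ln v <= 2 sqrt v], and [2 kappa sqrt v <= v/2] as soon as [4 kappa <= sqrt v]. *)
Lemma ln_small (kappa v : R) :
  0 <= kappa -> 0 < v -> (4 * kappa)^2 <= v -> kappa * ln v <= v / 2.
Proof.
  intros Hk Hv H. set (s := sqrt v).
  assert (Hs : 0 < s) by (apply sqrt_lt_R0, Hv).
  assert (Es : s^2 = v) by (apply pow2_sqrt; lra).
  assert (Hln : ln v <= 2 * s).
  { rewrite -Es -Rpower_pow // ln_Rpower.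
    assert (ln s <= s).
    { pose proof (exp_ineq1_le (ln s)) as He. rewrite exp_ln in He; lra. }
    simpl. lra. }
  assert (4 * kappa <= s) by (apply Rnot_lt_le; intros Hlt; nra).
  apply Rle_trans with (kappa * (2 * s)); [apply Rmult_le_compat_l; lra|].
  rewrite -Es. nra.
Qed.

Lemma Rabs_ln_diff (m x y : R) :
  0 < m -> m <= x -> m <= y -> Rabs (ln x - ln y) <= Rabs (x - y) / m.
Proof.
  intros Hm Hx Hy.
  assert (Hmin : m <= Rmin y x) by (apply Rmin_glb; lra).
  destruct (MVT_gen ln y x Rinv) as [z [Hz E]].
  - intros z Hz. apply is_derive_ln. lra.
  - intros z Hz. apply (is_derive_continuity_pt _ _ (/ z)), is_derive_ln. lra.
  - rewrite E Rabs_mult Rmult_comm. apply Rmult_le_compat_l; [apply Rabs_pos|].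
    rewrite Rabs_pos_eq; [|left; apply Rinv_0_lt_compat; lra].
    apply Rinv_le_contravar; lra.
Qed.

Lemma Rabs_Rpower_diff (p m x y : R) :
  0 < p < 1 -> 0 < m -> m <= x -> m <= y ->
  Rabs (Rpower x p - Rpower y p) <= Rpower m (p - 1) * Rabs (x - y).
Proof.
  intros Hp Hm Hx Hy.
  assert (Hmin : m <= Rmin y x) by (apply Rmin_glb; lra).
  assert (Hd : forall z, 0 < z -> is_derive (fun z => Rpower z p) z (p * Rpower z (p - 1))).
  { intros z Hz. apply is_derive_Reals, derivable_pt_lim_power, Hz. }
  destruct (MVT_gen (fun z => Rpower z p) y x (fun z => p * Rpower z (p - 1))) as [z [Hz E]].
  - intros z Hz. apply Hd. lra.
  - intros z Hz. eapply is_derive_continuity_pt, Hd. lra.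
  - rewrite E Rabs_mult. apply Rmult_le_compat_r; [apply Rabs_pos|].
    pose proof (Rpower_gt0 z (p - 1)).
    rewrite Rabs_pos_eq; [|nra].
    assert (Rpower z (p - 1) <= Rpower m (p - 1)); [|nra].
    replace (p - 1) with (- (1 - p)) by ring. rewrite !Rpower_Ropp.
    apply Rinv_le_contravar; [apply Rpower_gt0|apply Rle_Rpower_l; lra].
Qed.

(** Replacing [ln v] by [ln t] costs [O(ln v / v)], which dominates [C / v]; the power [p]
    multiplies this by [v^(p-1)]. The bound uses [t/2] since [t/2 = -ln |x|] in the application. *)
Lemma root_asymptotics (p a c C : R) :
  0 < p < 1 ->
  exists V0 K, forall v t, V0 <= v -> Rabs (t - (v + a * ln v - c)) <= C / v ->
    0 < v /\ 2 < t /\ 0 < t - a * ln t + c /\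
    Rabs (Rpower v p - Rpower (t - a * ln t + c) p)
      <= K * (ln (t / 2) / Rpower (t / 2) (2 - p)).
Proof.
  intros Hp.
  pose proof (Rabs_pos a) as Ha. pose proof (Rabs_pos c) as Hc. pose proof (Rabs_pos C) as HC.
  set (k1 := Rabs a + Rabs c + Rabs C). set (k2 := 2 * k1 * Rabs a + Rabs C).
  assert (Hk1 : 0 <= k1) by (unfold k1; lra).
  assert (Hk2 : 0 <= k2) by (unfold k2; nra).
  (* [k1] bounds [|t - v|] against [ln v], and [k2] bounds the error of the inversion against
     [ln v / v]; the squares are the thresholds of [ln_small]. From [v >= 16] and [t >= v/2] follows
     [v <= (t/2)^2], needed to compare the logarithms. *)
  exists (16 + (4 * k1)^2 + (4 * k2)^2), (4 * k2). intros v t Hv Ht.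
  pose proof (pow2_ge_0 (4 * k1)). pose proof (pow2_ge_0 (4 * k2)).
  assert (Hv0 : 16 <= v) by lra.
  pose proof (ln_small k1 v Hk1 ltac:(lra) ltac:(lra)) as L1.
  pose proof (ln_small k2 v Hk2 ltac:(lra) ltac:(lra)) as L2.
  assert (Hl : 1 <= ln v).
  { rewrite -(ln_exp 1). apply ln_le; [apply exp_pos|]. pose proof exp_le_3. lra. }
  assert (HCv : C / v <= Rabs C * (ln v / v)).
  { unfold Rdiv. rewrite -Rmult_assoc. apply Rmult_le_compat_r.
    - left; apply Rinv_0_lt_compat; lra.
    - pose proof (Rle_abs C). nra. }
  assert (Hlv : ln v / v <= ln v).
  { apply (Rmult_le_reg_r v); [lra|]. replace (ln v / v * v) with (ln v) by (field; lra). nra. }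
  assert (Htv : Rabs (t - v) <= k1 * ln v).
  { replace (t - v) with ((t - (v + a * ln v - c)) + (a * ln v - c)) by ring.
    eapply Rle_trans; [apply Rabs_triang|].
    assert (Rabs (a * ln v - c) <= Rabs a * ln v + Rabs c * ln v).
    { eapply Rle_trans; [apply Rabs_triang|].
      rewrite Rabs_Ropp Rabs_mult (Rabs_pos_eq (ln v)); [|lra]. nra. }
    assert (Rabs C * (ln v / v) <= Rabs C * ln v) by (apply Rmult_le_compat_l; lra).
    unfold k1. lra. }
  assert (Htv2 : v / 2 <= t <= 3 / 2 * v) by (apply Rabs_le_between in Htv; lra).
  assert (Hln : Rabs (ln t - ln v) <= 2 * k1 * (ln v / v)).
  { eapply Rle_trans; [apply (Rabs_ln_diff (v / 2)); lra|].
    replace (2 * k1 * (ln v / v)) with (k1 * ln v / (v / 2)) by (field; lra).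
    apply Rmult_le_compat_r; [left; apply Rinv_0_lt_compat; lra|exact Htv]. }
  set (phi := t - a * ln t + c).
  assert (Hphi : Rabs (v - phi) <= k2 * (ln v / v)).
  { replace (v - phi) with (a * (ln t - ln v) - (t - (v + a * ln v - c))) by (unfold phi; ring).
    eapply Rle_trans; [apply Rabs_triang|]. rewrite Rabs_Ropp Rabs_mult.
    assert (Rabs a * Rabs (ln t - ln v) <= Rabs a * (2 * k1 * (ln v / v)))
      by (apply Rmult_le_compat_l; lra).
    unfold k2. lra. }
  assert (Hphi2 : v / 2 <= phi).
  { assert (k2 * (ln v / v) <= k2 * ln v) by (apply Rmult_le_compat_l; lra).
    apply Rabs_le_between in Hphi. lra. }
  split; [lra|split; [lra|split; [lra|]]].
  eapply Rle_trans; [apply (Rabs_Rpower_diff p (v / 2)); lra|].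
  assert (Hv1 : Rpower v (p - 1) / v = / Rpower v (2 - p)).
  { rewrite -Rpower_Ropp. replace (- (2 - p)) with ((p - 1) + - (1)) by ring.
    rewrite Rpower_plus (Rpower_Ropp _ 1) Rpower_1 //. lra. }
  assert (Hhalf : Rpower (v / 2) (p - 1) <= 2 * Rpower v (p - 1)).
  { unfold Rdiv. rewrite -Rpower_mult_distr; [|lra|lra]. rewrite Rmult_comm.
    apply Rmult_le_compat_r; [left; apply Rpower_gt0|].
    unfold Rpower. rewrite ln_Rinv; [|lra].
    rewrite -{2}(exp_ln 2); [|lra]. apply exp_le.
    assert (0 <= ln 2) by (rewrite -ln_1; apply ln_le; lra). nra. }
  assert (Hlog : ln v <= 2 * ln (t / 2)).
  { replace (2 * ln (t / 2)) with (ln ((t / 2)^2)).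
    - apply ln_le; nra.
    - rewrite -Rpower_pow; [|lra]. rewrite ln_Rpower. simpl. ring. }
  assert (Hpow : / Rpower v (2 - p) <= / Rpower (t / 2) (2 - p)).
  { apply Rinv_le_contravar; [apply Rpower_gt0|apply Rle_Rpower_l; lra]. }
  apply Rle_trans with (2 * Rpower v (p - 1) * (k2 * (ln v / v))).
  { apply Rmult_le_compat; try assumption; [left; apply Rpower_gt0|apply Rabs_pos]. }
  replace (2 * Rpower v (p - 1) * (k2 * (ln v / v)))
    with (2 * k2 * (ln v * (Rpower v (p - 1) / v))) by (field; lra).
  rewrite Hv1.
  replace (4 * k2 * (ln (t / 2) / Rpower (t / 2) (2 - p)))
    with (2 * k2 * (2 * ln (t / 2) * / Rpower (t / 2) (2 - p)))
    by (field; apply Rgt_not_eq, Rpower_gt0).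
  apply Rmult_le_compat_l; [lra|].
  apply Rmult_le_compat; try lra. left. apply Rinv_0_lt_compat, Rpower_gt0.
Qed.

(** * Euclidean norm and punctured neighbourhoods of the origin *)

Lemma euclid_norm_sq (p : R * R) : euclid_norm p ^ 2 = fst p ^ 2 + snd p ^ 2.
Proof.
  unfold euclid_norm. rewrite pow2_sqrt //.
  pose proof (pow2_ge_0 (fst p)). pose proof (pow2_ge_0 (snd p)). lra.
Qed.

Lemma ln_inv_euclid_norm_sq (p : R * R) : 0 < fst p ^ 2 + snd p ^ 2 ->
  ln (1 / euclid_norm p ^ 2) = - ln (fst p ^ 2 + snd p ^ 2).
Proof.
  intros H. rewrite euclid_norm_sq. unfold Rdiv. rewrite Rmult_1_l ln_Rinv //.
Qed.

Lemma ln_euclid_norm (p : R * R) : 0 < fst p ^ 2 + snd p ^ 2 ->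
  - ln (euclid_norm p) = - ln (fst p ^ 2 + snd p ^ 2) / 2.
Proof.
  intros H. unfold euclid_norm. rewrite -Rpower_sqrt // ln_Rpower. field.
Qed.

Lemma locally'_origin (t1 : R) :
  locally' ((0, 0) : R * R) (fun p : R * R =>
    0 < fst p ^ 2 + snd p ^ 2 /\ t1 < - ln (fst p ^ 2 + snd p ^ 2)).
Proof.
  (* Balls of the product are squares; half the radius keeps the square inside the disc. *)
  assert (He : 0 < exp (- t1 / 2) / 2) by (pose proof (exp_pos (- t1 / 2)); lra).
  exists (mkposreal _ He). intros [x y] [Hx Hy] Hne.
  change (Rabs (x - 0) < exp (- t1 / 2) / 2) in Hx.
  change (Rabs (y - 0) < exp (- t1 / 2) / 2) in Hy.
  rewrite Rminus_0_r in Hx. rewrite Rminus_0_r in Hy. simpl fst; simpl snd.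
  assert (Hpos : 0 < x^2 + y^2).
  { pose proof (pow2_ge_0 x). pose proof (pow2_ge_0 y).
    destruct (Req_dec x 0) as [->|Hx0]; [|pose proof (pow2_gt_0 x Hx0); lra].
    destruct (Req_dec y 0) as [->|Hy0]; [now elim Hne|pose proof (pow2_gt_0 y Hy0); lra]. }
  split; [exact Hpos|].
  assert (Hlt : x^2 + y^2 < exp (- t1)).
  { replace (exp (- t1)) with (exp (- t1 / 2) ^ 2).
    - apply Rabs_lt_between in Hx, Hy. set (e := exp (- t1 / 2)) in *. nra.
    - simpl. rewrite Rmult_1_r -exp_plus. f_equal. field. }
  apply ln_increasing in Hlt; [|exact Hpos]. rewrite ln_exp in Hlt. lra.
Qed.

Theorem corollary2p1 :
  forall q r : R, 1 < q ->
  exists u : R -> R -> R,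
    singular_solution (fun t : R => rpow t r * exp (rpow t q)) u /\
    is_bigO (locally' ((0, 0) : R * R))
      (fun p : R * R =>
         u (fst p) (snd p) -
         rpow (ln (1 / euclid_norm p ^ 2)
               - (2 * q + r - 1) / q * ln (ln (1 / euclid_norm p ^ 2))
               + ln (4 * (q - 1) / q ^ 2))
              (1 / q))
      (fun p : R * R =>
         ln (- ln (euclid_norm p)) / rpow (- ln (euclid_norm p)) (2 - 1 / q)).
Proof.
  intros q r Hq.
  destruct (emden_ode_solution q r Hq) as [W [W1 [W2 [t0 [C [HW Hinf]]]]]].
  assert (HWd : forall t, t0 < t -> is_derive W t (W1 t)) by (intros; now apply HW).
  assert (HW1d : forall t, t0 < t -> is_derive W1 t (W2 t)) by (intros; now apply HW).
  assert (HW2c : forall t, t0 < t -> continuous W2 t) by (intros; now apply HW).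
  exists (radial W). split; [split|].
  (* [|x| < exp (-t0/2)] amounts to [t > t0]. *)
  - exists (exp (- t0 / 2)).
    assert (HD : forall x y, punctured_ball (exp (- t0 / 2)) (x, y) ->
      0 < x^2 + y^2 /\ t0 < - ln (x^2 + y^2)).
    { intros x y [H1 H2].
      pose proof (euclid_norm_sq (x, y)) as En. simpl fst in En; simpl snd in En.
      rewrite -En. split; [apply pow_lt, H1|].
      rewrite -Rpower_pow // ln_Rpower.
      apply ln_increasing in H2; [|exact H1]. rewrite ln_exp in H2. simpl. lra. }
    split; [apply exp_pos|split].
    + intros x y Hxy. apply (radial_C2 W W1 W2 t0); auto.
    + intros x y Hxy. destruct (HD x y Hxy) as [Hn Ht].
      destruct (HW _ Ht) as [_ [_ [_ [Hpos [Heq _]]]]].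
      rewrite (radial_laplacian W W1 W2 t0); auto. unfold radial.
      rewrite !rpow_pos // -Heq. split; [lra|ring].
  - intros P [M HM]. unfold filtermap.
    destruct (Hinf (Rpower (Rmax M 1) q)) as [t1 Ht1].
    generalize (locally'_origin (Rmax t0 t1)). apply filter_imp.
    intros [x y] [Hn Ht]. simpl fst in *; simpl snd in *. apply HM. unfold radial.
    pose proof (Rmax_l t0 t1). pose proof (Rmax_r t0 t1).
    set (t := - ln (x^2 + y^2)) in *.
    destruct (HW t ltac:(lra)) as [_ [_ [_ [Hpos _]]]].
    specialize (Ht1 t ltac:(lra) ltac:(lra)).
    apply Rnot_le_lt. intros Hle. pose proof (Rmax_l M 1).
    assert (Rpower (W t) q <= Rpower (Rmax M 1) q) by (apply Rle_Rpower_l; lra). lra.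
  - assert (Hp : 0 < 1 / q < 1).
    { split; [apply Rdiv_lt_0_compat; lra|]. apply (Rmult_lt_reg_r q); [lra|].
      replace (1 / q * q) with 1 by (field; lra). lra. }
    destruct (root_asymptotics (1 / q) ((2 * q + r - 1) / q) (ln (4 * (q - 1) / q^2)) C Hp)
      as [V0 [K HK]].
    destruct (Hinf V0) as [t1 Ht1]. exists K.
    generalize (locally'_origin (Rmax t0 t1)). apply filter_imp.
    intros [x y] [Hn Ht].
    rewrite (ln_inv_euclid_norm_sq (x, y) Hn) (ln_euclid_norm (x, y) Hn).
    unfold radial. simpl fst in *; simpl snd in *.
    pose proof (Rmax_l t0 t1). pose proof (Rmax_r t0 t1).
    set (t := - ln (x ^ 2 + y ^ 2)) in *.
    destruct (HW t ltac:(lra)) as [_ [_ [_ [Hpos [_ Hasym]]]]].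
    (* With [v = W^q] and [p = 1/q], the power [v^p] is [W] itself. *)
    destruct (HK (Rpower (W t) q) t) as [_ [Ht2 [Hphi Hmain]]];
      [left; apply Ht1; lra|exact Hasym|].
    rewrite Rpower_mult in Hmain. replace (q * (1 / q)) with 1 in Hmain by (field; lra).
    rewrite Rpower_1 // in Hmain.
    rewrite !rpow_pos; [|lra|exact Hphi].
    rewrite (Rabs_pos_eq (ln (t / 2) / _)); [exact Hmain|].
    apply Rmult_le_pos; [rewrite -ln_1; apply ln_le; lra|].
    left. apply Rinv_0_lt_compat, Rpower_gt0.
Qed.
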